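(* Suppose $a,b,d\in \mathbf{Z}$, $b\ge 1$ and $\gcd(a,b)=1$. Let $\ell$ be a prime divisor of $a+db$ and let $r$ be an integer with $0\leq r<\ell$. Suppose $d,\ell$ and $r$ satisfy any of the following conditions: (1) $d=1$ and $24r+1$ is a quadratic non-residue modulo $\ell$; (2) $d=3$ and either $8r+1$ is a quadratic non-residue modulo $\ell$ or $8r+1\equiv 0 \pmod{\ell}$; (3) $d\in\{4,8,14\}$, $\ell\equiv 5\pmod 6$ and $24r+d\equiv 0\pmod{\ell}$; (4) $d\in\{6,10\}$, $\ell\ge 5$, $\ell\equiv 3\pmod 4$ and $24r+d\equiv 0\pmod{\ell}$; (5) $d=26$, $\ell\equiv 11\pmod{12}$ and $24r+d\equiv 0\pmod{\ell}$. Then for all integers $n\geq 0$, $$p_{-a/b}(\ell n+r) \equiv 0 \pmod{\ell}.$$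
   Context: For a rational number $k$, the rational numbers $p_k(n)$ ($n\ge 0$) are the coefficients of the power series $\sum_{n=0}^{\infty}p_{k}(n)q^n=(q;q)_{\infty}^{k}$, where $(q;q)_\infty=\prod_{m=1}^{\infty}(1-q^m)$ and the power is defined by $(q;q)_\infty^{k}=\prod_{m=1}^\infty(1-q^m)^{k}$, each factor being expanded by the generalized binomial theorem $(1-x)^k=\sum_{i\ge 0}\binom{k}{i}(-1)^i x^i$. A rational number $x$ whose reduced denominator is coprime to a positive integer $M$ satisfies $x\equiv 0\pmod M$ if $M$ divides the numerator of $x$ in reduced form. (When $k$ has reduced denominator $b$, every prime dividing the denominator of $p_k(n)$ divides $b$; and here $\gcd(\ell,b)=1$, so the congruence is meaningful.) *)

(* Defs.v *)
From mathcomp Require Import all_boot all_order all_algebra.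
Set Implicit Arguments.
Unset Strict Implicit.
Unset Printing Implicit Defensive.
Import Order.TTheory GRing.Theory Num.Theory.
Local Open Scope ring_scope.

(* A formal power series over the rationals is its coefficient sequence. *)
Definition fps := nat -> rat.

Definition fps_one : fps := fun n => (n == 0)%:R.

Definition fps_mul (f g : fps) : fps :=
  fun n => \sum_(i < n.+1) f i * g (n - i)%N.

Definition gbinom (k : rat) (i : nat) : rat :=
  (\prod_(j < i) (k - j%:R)) / (i`!)%:R.

(* (1 - q^m)^k, m > 0: the generalized binomial series of (1 - x)^k at
   x = q^m, which only has exponents i * m. *)
Definition one_sub_qpow (k : rat) (m : nat) : fps :=
  fun n => if (m %| n)%N then gbinom k (n %/ m) * (-1) ^+ (n %/ m) else 0.

(* prod_(1 <= m <= N) (1 - q^m)^k *)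
Fixpoint qprod (k : rat) (N : nat) : fps :=
  if N is N'.+1 then fps_mul (qprod k N') (one_sub_qpow k N'.+1) else fps_one.

(* The coefficient of q^n in the infinite product, i.e. the eventual value of
   the coefficient of q^n in the partial products; it is already reached at
   N = n, see [qprod_stable]. *)
Definition pcoef (k : rat) (n : nat) : rat := qprod k n n.

Lemma qprod_stable (k : rat) (n N : nat) :
  (n <= N)%N -> qprod k N n = pcoef k n.
Proof.
elim: N => [|N IH]; first by rewrite leqn0 => /eqP ->.
rewrite leq_eqVlt => /predU1P[-> //|]; rewrite ltnS => le_nN.
rewrite -(IH le_nN) /= /fps_mul big_ord_recr /= subnn big1 => [|i _].
  by rewrite /one_sub_qpow dvdn0 div0n /gbinom big_ord0 fact0 divr1 add0r.
rewrite /one_sub_qpow gtnNdvd ?mulr0 ?subn_gt0 //.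
by rewrite ltnS (leq_trans (leq_subr _ _)).
Qed.

Definition quad_nonresidue (l : nat) (x : int) : Prop :=
  ~~ (l %| x)%Z /\ ~ (exists y : int, (y ^+ 2 = x %[mod l])%Z).

Definition rat_eqmod0 (x : rat) (M : nat) : Prop :=
  coprimez (denq x) M /\ (M %| numq x)%Z.

(* Main.v *)
From HB Require Import structures.
Require Import Defs.
From mathcomp Require Import all_boot all_order all_algebra all_field.
From mathcomp Require Import zify ring.
From mathcomp Require boolp.
Set Implicit Arguments.
Unset Strict Implicit.
Unset Printing Implicit Defensive.
Import Order.TTheory GRing.Theory Num.Theory.
Local Open Scope ring_scope.

(** Put t = q^(1/24), D = t d/dt and eta_k = t^k prod (1 - t^(24 k m)), so that
    p_d(n) is the coefficient of t^(24 n + d) in eta_1^d.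

    Since l divides a + d b, -a/b is l-adically close to a natural number
    d + l m, and (q; q)^(d + l m) = (q; q)^d (q^l; q^l)^m modulo l; hence it is
    enough to treat the exponent d.  For d = 1 and d = 3 this is read off Euler's
    and Jacobi's theta series.  For the other d, a nonzero multiple of eta_1^d
    is a combination of series sum c(x, y) P(x, y) t^(m x^2 + m' y^2) with P
    homogeneous of positive degree and m x^2 + m' y^2 anisotropic modulo l: if l
    divides 24 n + d, it divides x and y, hence P(x, y).

    These combinations are products or Rankin-Cohen brackets of theta series of
    one variable (for d = 8 the bracket is a multiple of eta_1^8 + 32 eta_4^8, for
    d = 26 two brackets are needed).  To evaluate them, let y = theta_4^4,
    z = theta_2^4 and let U be the logarithmic derivative of eta_1.  Rotating the Gaussian lattice turns
    Wronskians of theta constants into sixth powers of eta_1 and eta_4; rotating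
    the Eisenstein lattice by a cube root of unity z -> w z, once with the weight
    Re z and once with Re z^5, gives the product formula of a theta series of
    weight 3/2 and a second order differential relation.  Together these make
    Z[U, y, z] stable under D (a form of Ramanujan's differential equations), and
    each bracket becomes a polynomial identity in U, y, z. *)

(** * Formal power series *)

(** A record around the coefficient function lets the Cauchy product be declared as its ring
    structure. *)
Record fseries (R : Type) := Fseries { scoef :> nat -> R }.

Lemma fseriesP (R : Type) (f g : fseries R) : f =1 g -> f = g.
Proof.
case: f g => [f] [g] /= fg; congr Fseries.
exact: boolp.functional_extensionality_dep.
Qed.

HB.instance Definition _ (R : Type) := boolp.gen_eqMixin (fseries R).
HB.instance Definition _ (R : Type) := boolp.gen_choiceMixin (fseries R).

Section SeriesRing.
Variable R : comNzRingType.
Implicit Types f g h : fseries R.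

Definition sadd f g := Fseries (fun n => f n + g n).
Definition sopp f := Fseries (fun n => - f n).
Definition szero : fseries R := Fseries (fun _ => 0).
Definition sone : fseries R := Fseries (fun n => (n == 0)%:R).
Definition smul f g := Fseries (fun n => \sum_(i < n.+1) f i * g (n - i)%N).

Fact saddA : associative sadd.
Proof. by move=> f g h; apply: fseriesP => n /=; rewrite addrA. Qed.
Fact saddC : commutative sadd.
Proof. by move=> f g; apply: fseriesP => n /=; rewrite addrC. Qed.
Fact sadd0 : left_id szero sadd.
Proof. by move=> f; apply: fseriesP => n /=; rewrite add0r. Qed.
Fact saddN : left_inverse szero sopp sadd.
Proof. by move=> f; apply: fseriesP => n /=; rewrite addNr. Qed.

HB.instance Definition _ :=
  GRing.isZmodule.Build (fseries R) saddA saddC sadd0 saddN.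

Definition strunc n f : {poly R} := \poly_(i < n) f i.

Lemma coef_strunc n f i : (i < n)%N -> (strunc n f)`_i = f i.
Proof. by move=> lt_in; rewrite coef_poly lt_in. Qed.

(** Each coefficient of a product depends on finitely many coefficients of the factors, so
    commutativity and associativity are inherited from polynomials. *)
Lemma smul_trunc f g n m : (n < m)%N ->
  smul f g n = (strunc m f * strunc m g)`_n.
Proof.
move=> lt_nm; rewrite coefM /=; apply: eq_bigr => i _.
by rewrite !coef_strunc //; have := ltn_ord i; lia.
Qed.

Fact smulC : commutative smul.
Proof.
by move=> f g; apply: fseriesP => n; rewrite !(smul_trunc _ _ (ltnSn n)) mulrC.
Qed.

Lemma coefM_low (p q r : {poly R}) n :
  (forall i, (i <= n)%N -> p`_i = q`_i) -> (p * r)`_n = (q * r)`_n.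
Proof. by move=> pq; rewrite !coefM; apply: eq_bigr => i _; rewrite pq // -ltnS. Qed.

Fact smulA : associative smul.
Proof.
move=> f g h; apply: fseriesP => n.
have H f' g' h' : smul (smul f' g') h' n =
    (strunc n.+1 f' * strunc n.+1 g' * strunc n.+1 h')`_n.
  rewrite (smul_trunc _ _ (ltnSn n)); apply: coefM_low => i le_in.
  by rewrite coef_strunc //; apply: smul_trunc.
by rewrite smulC !H mulrC mulrA.
Qed.

Fact smul1 : left_id sone smul.
Proof.
move=> f; apply: fseriesP => n /=.
by rewrite big_ord_recl big1 /= ?mul1r ?subn0 ?addr0 // => i _; rewrite mul0r.
Qed.

Fact smulDl : left_distributive smul sadd.
Proof.
move=> f g h; apply: fseriesP => n /=.
by rewrite -big_split; apply: eq_bigr => i _; rewrite mulrDl.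
Qed.

Fact sone_neq0 : sone != 0.
Proof.
apply/eqP => /(congr1 (fun f : fseries R => f 0%N)) /= /eqP.
by rewrite oner_eq0.
Qed.

HB.instance Definition _ := GRing.Zmodule_isComNzRing.Build (fseries R)
  smulA smulC smul1 smulDl sone_neq0.

Lemma scoefD f g n : (f + g) n = f n + g n. Proof. by []. Qed.
Lemma scoefN f n : (- f) n = - f n. Proof. by []. Qed.
Lemma scoefB f g n : (f - g) n = f n - g n. Proof. by []. Qed.
Lemma scoef0 n : (0 : fseries R) n = 0. Proof. by []. Qed.
Lemma scoef1 n : (1 : fseries R) n = (n == 0)%:R. Proof. by []. Qed.
Lemma scoefM f g n : (f * g) n = \sum_(i < n.+1) f i * g (n - i)%N.
Proof. by []. Qed.
Lemma scoefMn f k n : (f *+ k) n = f n *+ k.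
Proof. by elim: k => [|k IH]; rewrite ?mulr0n // !mulrSr scoefD IH. Qed.
Lemma scoef_nat k f n : (k%:R * f) n = k%:R * f n.
Proof. by rewrite !mulr_natl scoefMn. Qed.
Lemma scoef_sum (I : Type) (r : seq I) (P : pred I) (F : I -> fseries R) n :
  (\sum_(i <- r | P i) F i) n = \sum_(i <- r | P i) F i n.
Proof. by elim/big_rec2: _ => // i y f _ <-. Qed.

Definition spoly (p : {poly R}) : fseries R := Fseries (fun n => p`_n).

Fact spoly_is_additive : zmod_morphism spoly.
Proof. by move=> p q; apply: fseriesP => n /=; rewrite coefB. Qed.
Fact spoly_is_multiplicative : monoid_morphism spoly.
Proof.
split; first by apply: fseriesP => n /=; rewrite coef1.
by move=> p q; apply: fseriesP => n /=; rewrite coefM.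
Qed.

HB.instance Definition _ := GRing.isZmodMorphism.Build _ _ spoly spoly_is_additive.
HB.instance Definition _ :=
  GRing.isMonoidMorphism.Build _ _ spoly spoly_is_multiplicative.

Definition sX : fseries R := spoly 'X.

Lemma sXnE m : sX ^+ m = Fseries (fun n => (n == m)%:R).
Proof. by rewrite -rmorphXn; apply: fseriesP => n /=; rewrite coefXn. Qed.

Lemma scoefXnM m f n : (sX ^+ m * f) n = if (n < m)%N then 0 else f (n - m)%N.
Proof.
rewrite scoefM sXnE; case: ltnP => [lt_nm|le_mn].
  rewrite big1 // => i _ /=; have := ltn_ord i.
  by case: eqP => [->|]; [lia | rewrite mul0r].
rewrite (bigD1 (Ordinal (leq_ltn_trans le_mn (ltnSn n)))) //= eqxx mul1r.
rewrite big1 ?addr0 // => i; rewrite -val_eqE /= => /negbTE ->.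
by rewrite mul0r.
Qed.

(** The operator [D = t d/dt] rather than [d/dt]: being diagonal on monomials, it multiplies a theta
    term by its exponent. *)
Definition sder f := Fseries (fun n => n%:R * f n).

Lemma sderE f n : sder f n = n%:R * f n. Proof. by []. Qed.

Fact sder_is_additive : zmod_morphism sder.
Proof. by move=> f g; apply: fseriesP => n; rewrite scoefB !sderE scoefB mulrBr. Qed.
HB.instance Definition _ :=
  GRing.isZmodMorphism.Build _ _ sder sder_is_additive.

Lemma sderM f g : sder (f * g) = sder f * g + f * sder g.
Proof.
apply: fseriesP => n; rewrite scoefD sderE !scoefM mulr_sumr -big_split /=.
apply: eq_bigr => i _.
have -> : n%:R = i%:R + (n - i)%:R :> R by rewrite -natrD subnKC // -ltnS.
ring.
Qed.

Lemma sder1 : sder 1 = 0.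
Proof. by apply: fseriesP => -[|n]; rewrite sderE scoef1 ?mul0r ?mulr0. Qed.

Lemma sderX f n : sder (f ^+ n.+1) = n.+1%:R * f ^+ n * sder f.
Proof.
elim: n => [|n IH]; first by rewrite expr0 !mul1r.
by rewrite exprS sderM IH !exprS -[n.+2%:R]natr1; ring.
Qed.

Lemma sder_natM k f : sder (k%:R * f) = k%:R * sder f.
Proof. by rewrite !mulr_natl raddfMn. Qed.

(** Congruence modulo [t^M]; infinite products are compared through their partial products modulo
    every [t^M]. *)
Definition eqst M f g := forall n, (n < M)%N -> f n = g n.

Lemma eqst_refl M f : eqst M f f. Proof. by []. Qed.
Lemma eqst_sym M f g : eqst M f g -> eqst M g f.
Proof. by move=> fg n /fg. Qed.
Lemma eqst_trans M f g h : eqst M f g -> eqst M g h -> eqst M f h.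
Proof. by move=> fg gh n lt_nM; rewrite fg ?gh. Qed.
Lemma eqstD M f f' g g' : eqst M f f' -> eqst M g g' -> eqst M (f + g) (f' + g').
Proof. by move=> ff gg n lt_nM; rewrite !scoefD ff ?gg. Qed.
Lemma eqstM M f f' g g' : eqst M f f' -> eqst M g g' -> eqst M (f * g) (f' * g').
Proof.
move=> ff gg n lt_nM; rewrite !scoefM; apply: eq_bigr => i _.
by have := ltn_ord i => lt_in; rewrite ff ?gg //; lia.
Qed.

Lemma eqst_sum M (I : eqType) (r : seq I) (F G : I -> fseries R) :
  (forall i, i \in r -> eqst M (F i) (G i)) ->
  eqst M (\sum_(i <- r) F i) (\sum_(i <- r) G i).
Proof.
by move=> FG n lt_nM; rewrite !scoef_sum; apply: eq_big_seq => i /FG ->.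
Qed.

Lemma eqst_eq f g : (forall M, eqst M f g) -> f = g.
Proof. by move=> fg; apply: fseriesP => n; apply: (fg n.+1). Qed.

Lemma eqst_expr M f n : f 0%N = 0 -> (M <= n)%N -> eqst M (f ^+ n) 0.
Proof.
move=> f0; elim: n M => [|n IH] M le_Mn m lt_mM; first lia.
rewrite exprS scoefM big1 // => -[[|i] lt_i] _ /=; first by rewrite f0 mul0r.
by rewrite (IH M.-1) ?scoef0 ?mulr0 //; lia.
Qed.

(** Geometric series in [1 - f]: the partial sums [G n] stabilise coefficientwise because [1 - f]
    has no constant term. *)
Lemma series_inverse f : f 0%N = 1 -> exists g, f * g = 1.
Proof.
move=> f0; pose G n := \sum_(k < n) (1 - f) ^+ k.
have fG n : f * G n = 1 - (1 - f) ^+ n.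
  have := subrXX 1 (1 - f) n; rewrite expr1n subKr => ->; congr (_ * _).
  by apply: eq_bigr => i _; rewrite expr1n mul1r.
have f1 : (1 - f) 0%N = 0 by rewrite scoefB f0 subrr.
have GS n m : (n < m)%N -> G m n = G n.+1 n.
  elim: m => // m IH lt_nm; rewrite /G big_ord_recr scoefD.
  move: lt_nm; rewrite ltnS leq_eqVlt => /predU1P[<-|lt_nm].
    by rewrite [in RHS]big_ord_recr.
  by rewrite -/(G m) IH // (eqst_expr f1 (leqnn m) lt_nm) scoef0 addr0.
exists (Fseries (fun n => G n.+1 n)); apply: eqst_eq => M n lt_nM.
have -> : (f * Fseries (fun n => G n.+1 n)) n = (f * G M) n.
  by apply: (eqstM (eqst_refl f) _ lt_nM) => m lt_mM /=; rewrite GS.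
by rewrite fG scoefB (eqst_expr f1 (leqnn M)) // subr0.
Qed.
End SeriesRing.

Section SeriesDomain.
Variable R : idomainType.
Implicit Types f g h : fseries R.

Lemma smulf_eq0 f g : f != 0 -> f * g = 0 -> g = 0.
Proof.
have lead h : h != 0 -> exists2 n, h n != 0 & forall i, (i < n)%N -> h i = 0.
  move=> h_neq0; have /boolp.existsNP[n /eqP hn] : ~ forall n, h n = 0.
    by move=> h0; case/eqP: h_neq0; apply: fseriesP.
  have ex : exists n, h n != 0 by exists n.
  case: (ex_minnP ex) => m hm min_m; exists m => // i lt_im.
  by apply: contraTeq lt_im => /min_m; rewrite -leqNgt.
move=> /lead[m fm f_lt] fg0; case: (eqVneq g 0) => // /lead[n gn g_lt].
have := congr1 (fun h : fseries R => h (m + n)%N) fg0; rewrite scoefM scoef0.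
have lt_m : (m < (m + n).+1)%N by lia.
rewrite (bigD1 (Ordinal lt_m)) //= addKn big1 ?addr0.
  by move/eqP; rewrite mulf_eq0 (negbTE fm) (negbTE gn).
move=> i; rewrite -val_eqE /= => neq_im; have := ltn_ord i => lt_i.
case: (ltngtP i m) neq_im => // [/f_lt ->|lt_mi] _; first by rewrite mul0r.
by rewrite g_lt ?mulr0 //; lia.
Qed.

Lemma smulfI f g h : f != 0 -> f * g = f * h -> g = h.
Proof.
move=> f_neq0 /eqP; rewrite -subr_eq0 -mulrBr => /eqP /(smulf_eq0 f_neq0) /eqP.
by rewrite subr_eq0 => /eqP.
Qed.

Lemma smulf_neq0 f g : f != 0 -> g != 0 -> f * g != 0.
Proof. by move=> f0; apply: contra_neq => /(smulf_eq0 f0). Qed.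

Lemma sexpf_neq0 f n : f != 0 -> f ^+ n != 0.
Proof.
move=> f0; elim: n => [|n IH]; first by rewrite expr0 oner_eq0.
by rewrite exprS smulf_neq0.
Qed.
End SeriesDomain.

(** The argument is one less than the integer: [snatr_neq0 _ 15] serves to cancel 16. *)
Lemma snatr_neq0 (R : numDomainType) n : n.+1%:R != 0 :> fseries R.
Proof.
apply/eqP => /(congr1 (fun f : fseries R => f 0%N)) /= /eqP.
by rewrite scoefMn pnatr_eq0.
Qed.

(** For the difference [h], the coefficient of [t^n] in [D h = u h] expresses [(n - m) h_n] through
    earlier coefficients, so that only [h_m] is free. *)
Lemma log_derivative_inj (R : numDomainType) (u f g : fseries R) m :
  sder f = u * f -> sder g = u * g -> u 0%N = m%:R -> f m = g m -> f = g.
Proof.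
move=> Df Dg u0 fg_m; apply/eqP; rewrite -subr_eq0; apply/eqP.
have hm : (f - g) m = 0 by rewrite scoefB fg_m subrr.
have Dh : sder (f - g) = u * (f - g) by rewrite raddfB /= Df Dg mulrBr.
move: {f g Df Dg fg_m}(f - g) hm Dh => h hm Dh.
apply: fseriesP => n; elim/ltn_ind: n => n IH.
have := congr1 (fun s : fseries R => s n) Dh.
rewrite sderE scoefM big_ord_recl subn0 u0 big1 => [|i _]; last first.
  by rewrite IH ?mulr0 // lift0; have := ltn_ord i; lia.
rewrite addr0 scoef0 => /eqP; rewrite -subr_eq0 -mulrBl mulf_eq0 subr_eq0 eqr_nat.
by case/orP=> /eqP // ->.
Qed.

(** * The triple product *)

Definition box (n : nat) : seq int := [seq i%:Z - n%:Z | i <- iota 0 (n + n).+1].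

Lemma mem_box n (x : int) : (x \in box n) = (absz x <= n)%N.
Proof.
apply/mapP/idP => [[i]|le_xn]; first by rewrite mem_iota => lt_i ->; lia.
by exists (absz (x + n%:Z)); rewrite ?mem_iota; lia.
Qed.

Lemma box_uniq n : uniq (box n).
Proof. by rewrite map_inj_uniq ?iota_uniq // => i j; lia. Qed.

Section FiniteTripleProduct.
Variable T : comNzRingType.
Implicit Types A B p : T.

(** Gaussian binomials through a q-Pascal rule, which avoids division in [T]; [gaussb_qfact]
    recovers the usual quotient. *)
Fixpoint gaussb p N k : T :=
  match N, k with
  | _, 0 => 1
  | 0, _.+1 => 0
  | N'.+1, k'.+1 => gaussb p N' k' + p ^+ k * gaussb p N' k
  end.

Lemma gaussb0 p N : gaussb p N 0 = 1. Proof. by case: N. Qed.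

Lemma gaussb_small p N k : (N < k)%N -> gaussb p N k = 0.
Proof.
elim: N k => [|N IH] [|k] //= lt_Nk.
by rewrite !IH ?mulr0 ?addr0 //; lia.
Qed.

Lemma gaussbSS p N k :
  gaussb p N.+1 k.+1 = gaussb p N k + p ^+ k.+1 * gaussb p N k.+1.
Proof. by []. Qed.

(** The dual q-Pascal rule. In the finite triple product the defining rule drives the induction on
    [n], this one the induction on [m]. *)
Lemma gaussb_pascal p N k : (k <= N)%N ->
  gaussb p N.+1 k.+1 = p ^+ (N - k) * gaussb p N k + gaussb p N k.+1.
Proof.
elim: N k => [|N IH] [|k] // le_kN.
- by rewrite /= !expr0 mulr1 mulr0.
- rewrite [in LHS]gaussbSS [in RHS]gaussbSS [in LHS]IH // !gaussb0 !subn0.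
  by rewrite !exprS; ring.
have [lt_kN|eq_kN] : (k.+1 <= N)%N \/ k = N by lia.
  rewrite [LHS]gaussbSS [in LHS](IH k.+1) // [in LHS](IH k) 1?ltnW //.
  rewrite subSS !gaussbSS.
  have -> : (N - k = (N - k.+1).+1)%N by lia.
  by rewrite !exprS; ring.
rewrite eq_kN subnn expr0 mul1r [LHS]gaussbSS.
by rewrite !(gaussb_small _ (ltnSn _)) mulr0 addr0.
Qed.

Definition qfact p n := \prod_(i < n) (1 - p ^+ i.+1).

Lemma qfactS p n : qfact p n.+1 = qfact p n * (1 - p ^+ n.+1).
Proof. by rewrite /qfact big_ord_recr. Qed.

Lemma gaussb_qfact p a b :
  gaussb p (a + b) a * (qfact p a * qfact p b) = qfact p (a + b).
Proof.
have q0 : qfact p 0 = 1 by rewrite /qfact big_ord0.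
elim: a b => [|a IHa] b; first by rewrite gaussb0 q0 !mul1r.
elim: b => [|b IHb].
  rewrite addn0 q0 mulr1; suff -> : gaussb p a.+1 a.+1 = 1 by rewrite mul1r.
  by elim: {IHa}a => [|a IH]; rewrite gaussbSS (gaussb_small _ (ltnSn _)) mulr0 addr0.
rewrite addSn gaussbSS mulrDl.
have -> : gaussb p (a + b.+1) a * (qfact p a.+1 * qfact p b.+1) =
  qfact p (a + b.+1) * (1 - p ^+ a.+1).
  by rewrite -IHa !qfactS; ring.
have -> : p ^+ a.+1 * gaussb p (a + b.+1) a.+1 * (qfact p a.+1 * qfact p b.+1) =
  qfact p (a + b.+1) * (p ^+ a.+1 * (1 - p ^+ b.+1)).
  by rewrite -addSnnS -IHb [qfact p b.+1]qfactS; ring.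
by rewrite qfactS -addSn exprD; ring.
Qed.

(** [jterm] is the general term [A^(j(j+1)/2) B^(j(j-1)/2)] of Ramanujan's theta function. Both
    exponents are natural numbers, so no inverse of [A] or [B] occurs, even for negative [j]. *)
Definition tri1 (j : int) := (absz (j * (j + 1)))./2.
Definition tri2 (j : int) := (absz (j * (j - 1)))./2.
Definition jterm A B (j : int) := A ^+ tri1 j * B ^+ tri2 j.

Lemma jtermS A B n : jterm A B n.+1 = jterm A B n * (A * (A * B) ^+ n).
Proof.
rewrite /jterm exprMn.
have -> : tri1 n.+1 = (tri1 n + n.+1)%N.
  rewrite /tri1; have -> : absz (n.+1%:Z * (n.+1%:Z + 1)) = (absz (n%:Z * (n%:Z + 1))%R + n.+1.*2)%N by lia.
  by rewrite halfD odd_double andbF doubleK.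
have -> : tri2 n.+1 = (tri2 n + n)%N.
  rewrite /tri2; have -> : absz (n.+1%:Z * (n.+1%:Z - 1)) = (absz (n%:Z * (n%:Z - 1))%R + n.*2)%N.
    by case: n => [|n]; lia.
  by rewrite halfD odd_double andbF doubleK.
by rewrite !exprD exprS; ring.
Qed.

Lemma jtermN A B j : jterm A B (- j) = jterm B A j.
Proof.
rewrite /jterm /tri1 /tri2 mulrC; congr (_ ^+ _./2 * _ ^+ _./2); lia.
Qed.

(** Consecutive terms have ratio [A (A B)^(j-1)]; the equation is multiplied by [(A B)^n] to keep
    exponents nonnegative. *)
Lemma jterm_shift A B (j : int) m n : m.+1%:Z - n%:Z = j ->
  (A * B) ^+ n * jterm A B j = A * (A * B) ^+ m * jterm A B (j - 1).
Proof.
case: j => [[|j]|j] E.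
- have -> : n = m.+1 by lia.
  have -> : 0%:Z - 1 = - (1%:Z) by [].
  rewrite jtermN jtermS /jterm /tri1 /tri2 /= !exprS !expr0; move: (_ ^+ m) => q; ring.
- have -> : m = (j + n)%N by lia.
  have -> : j.+1%:Z - 1 = j by lia.
  rewrite jtermS exprD; move: (_ ^+ j) (_ ^+ n) => q r; ring.
have -> : n = (m.+1 + j.+1)%N by lia.
have -> : Negz j = - (j.+1%:Z) by [].
have -> : - (j.+1%:Z) - 1 = - (j.+2%:Z) by lia.
rewrite !jtermN (jtermS _ _ j.+1) exprD !exprS (mulrC B A).
by move: (_ ^+ m) (_ ^+ j) => q r; ring.
Qed.

Lemma finite_triple_product A B m n :
  (\prod_(i < m) (1 + A * (A * B) ^+ i)) * (\prod_(i < n) (1 + B * (A * B) ^+ i)) =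
  \sum_(k < (m + n).+1) gaussb (A * B) (m + n) k * jterm A B (k%:Z - n%:Z).
Proof.
set p := A * B.
elim: m => [|m IHm].
  rewrite big_ord0 mul1r add0n; elim: n => [|n IHn].
    by rewrite big_ord0 big_ord1 subrr /jterm /= !expr0 !mulr1.
  rewrite big_ord_recr /= IHn mulrDr mulr1 [RHS]big_ord_recl.
  rewrite gaussb0 mul1r.
  under [in RHS]eq_bigr => i _ do rewrite lift0 mulrDl.
  rewrite big_split /= addrCA; congr (_ + _).
    by apply: eq_bigr => i _; congr (_ * jterm _ _ _); lia.
  rewrite mulr_suml big_ord_recl big_ord_recr /= (gaussb_small _ (ltnSn _)) mulr0 mul0r addr0.
  congr (_ + _).
    rewrite gaussb0 mul1r /= !sub0r !jtermN mulrC.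
    have := @jterm_shift B A n.+1 n 0; rewrite expr0 mul1r (mulrC B A) => ->; last by lia.
    by congr (_ * jterm _ _ _); lia.
  apply: eq_bigr => i _; rewrite /bump /=.
  have := @jterm_shift B A (n%:Z - i%:Z) n i.+1.
  rewrite (mulrC B A) -/p => E.
  have -> : (1 + i)%N%:Z - n%:Z = - (n%:Z - i%:Z - 1) by lia.
  have -> : i.+1%:Z - n.+1%:Z = - (n%:Z - i%:Z) by lia.
  rewrite !jtermN add1n.
  rewrite [in RHS]mulrAC E; last by have := ltn_ord i; lia.
  ring.
rewrite big_ord_recr /= mulrAC IHm mulrDr mulr1 addSn [RHS]big_ord_recl.
under [in RHS]eq_bigr => i _ do rewrite lift0 -gaussbSS (gaussb_pascal _ (leq_ord i)) mulrDl.
rewrite big_split /= ?gaussb0 ?mul1r addrCA [in RHS]addrC; congr (_ + _); last first.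
  rewrite mulr_suml; apply: eq_bigr => i _.
  have := @jterm_shift A B (i.+1%:Z - n%:Z) m (m + n - i).
  have -> : i.+1%:Z - n%:Z - 1 = i%:Z - n%:Z by lia.
  rewrite -/p => E; rewrite [in RHS]mulrAC E; last by have := ltn_ord i; lia.
  ring.
rewrite big_ord_recl [in RHS]big_ord_recr /= gaussb0 mul1r.
by rewrite (gaussb_small _ (ltnSn _)) mul0r addr0.
Qed.
End FiniteTripleProduct.

Section TripleProduct.
Variable R : comNzRingType.
Implicit Types (p q A B f : fseries R) (w : int -> fseries R).

Lemma scoefM0 f g : (f * g) 0%N = f 0%N * g 0%N.
Proof. by rewrite scoefM big_ord1 subnn. Qed.

Lemma eqst_mul0 M f g : eqst M f 0 -> eqst M (g * f) 0.
Proof. by move=> f0; rewrite -(mulr0 g); apply: eqstM. Qed.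

Lemma qfact_coef0 p n : p 0%N = 0 -> qfact p n 0%N = 1.
Proof.
move=> p0; elim: n => [|n IH]; first by rewrite /qfact big_ord0.
rewrite qfactS scoefM0 IH mul1r scoefB scoef1.
by rewrite (eqst_expr p0 (leqnn n.+1)) // scoef0 subr0.
Qed.

Lemma qfact_stable p M n : p 0%N = 0 -> (M <= n)%N ->
  eqst M (qfact p n) (qfact p M).
Proof.
move=> p0; elim: n => [|n IH]; first by rewrite leqn0 => /eqP ->.
rewrite leq_eqVlt => /predU1P[->|]; first exact: eqst_refl.
rewrite ltnS => le_Mn; apply: eqst_trans (IH le_Mn).
rewrite qfactS mulrBr mulr1 => m lt_mM; rewrite scoefB.
by rewrite (eqst_mul0 _ (eqst_expr p0 _) lt_mM) ?scoef0 ?subr0 //; lia.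
Qed.

(** In [gaussb_qfact] all q-factorials agree modulo [t^M] with [qfact p M], one copy of which is
    then cancelled. *)
Lemma gaussb_limit p M a b : p 0%N = 0 -> (M <= a)%N -> (M <= b)%N ->
  eqst M (gaussb p (a + b) a * qfact p M) 1.
Proof.
move=> p0 le_Ma le_Mb; have [g qg] := series_inverse (qfact_coef0 M p0).
have E : eqst M (gaussb p (a + b) a * (qfact p M * qfact p M)) (qfact p M).
  apply: eqst_trans (eqst_trans _ (qfact_stable p0 (leq_trans le_Ma (leq_addr b a)))).
    2: by rewrite -gaussb_qfact; apply: eqst_refl.
  apply: eqstM; first exact: eqst_refl.
  by apply: eqstM; apply/eqst_sym/qfact_stable.
have := eqstM E (@eqst_refl _ M g); rewrite qg.
by rewrite mulrA -[X in eqst _ X]mulrA qg mulr1.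
Qed.

(** The weight [w] is arbitrary, so that one limit serves both the triple product and Jacobi's
    identity, where [w] comes from a derivative. *)
Lemma triple_limit p w M n : p 0%N = 0 -> (M + M <= n)%N ->
  (forall j : int, (M < absz j)%N -> eqst M (w j) 0) ->
  eqst M (qfact p n * \sum_(k < (n + n).+1) gaussb p (n + n) k * w (k%:Z - n%:Z))
    (\sum_(j <- box n) w j).
Proof.
move=> p0 le_Mn w0; rewrite big_map -(big_mkord xpredT (fun k =>
  gaussb p (n + n) k * w (k%:Z - n%:Z))) /index_iota subn0 mulr_sumr.
apply: eqst_sum => k; rewrite mem_iota add0n => /andP[_ lt_k].
(* Far terms vanish modulo [t^M]; for the others [n >= 2 M] keeps [k] at distance at least [M] from
   both ends, where the Gaussian binomial has reached its limit. *)
have [lt_Mk|le_kM] := ltnP M (absz (k%:Z - n%:Z)).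
  apply: eqst_trans (eqst_sym (w0 _ lt_Mk)).
  by rewrite mulrA; apply/eqst_mul0/w0.
rewrite mulrA -[X in eqst _ _ X]mul1r; apply: eqstM; last exact: eqst_refl.
have -> : (n + n = k + (n + n - k))%N by lia.
have kM : (M <= k)%N by lia.
have nM : (M <= n + n - k)%N by lia.
apply: eqst_trans (gaussb_limit p0 kM nM); rewrite mulrC.
by apply: eqstM; [apply: eqst_refl | apply: qfact_stable => //; lia].
Qed.

Lemma jterm_high A B M j : (A * B) 0%N = 0 -> (M < absz j)%N ->
  eqst M (jterm A B j) 0.
Proof.
have pos (C D : fseries R) (n : nat) : (C * D) 0%N = 0 -> (M <= n)%N ->
    eqst M (jterm C D n.+1) 0.
  move=> p0 le_Mn; rewrite jtermS mulrA.
  exact/eqst_mul0/eqst_expr.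
move=> p0; case: j => [[|n]|n] // lt_Mn; first exact: pos.
have -> : Negz n = - (n.+1%:Z) by [].
by rewrite jtermN; apply: pos => //; rewrite mulrC.
Qed.

Theorem triple_product A B M n : (A * B) 0%N = 0 -> (M + M <= n)%N ->
  eqst M (qfact (A * B) n * ((\prod_(i < n) (1 + A * (A * B) ^+ i)) *
                             (\prod_(i < n) (1 + B * (A * B) ^+ i))))
    (\sum_(j <- box n) jterm A B j).
Proof.
move=> p0 le_Mn; rewrite finite_triple_product.
by apply: triple_limit => // j; apply: jterm_high.
Qed.

End TripleProduct.

Lemma tri_double (j : int) :
  ((tri1 j).*2 = absz (j * (j + 1))) * ((tri2 j).*2 = absz (j * (j - 1))).
Proof.
have e1 : ~~ odd (absz (j * (j + 1))) by rewrite abszM oddM; lia.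
have e2 : ~~ odd (absz (j * (j - 1))) by rewrite abszM oddM; lia.
by split; rewrite -[RHS]odd_double_half ?(negbTE e1) ?(negbTE e2).
Qed.

Lemma tri_sub (j : int) : (tri1 j)%:Z - (tri2 j)%:Z = j.
Proof.
have [d1 d2] := tri_double j.
have p1 : 0 <= j * (j + 1) by case: j {d1 d2} => j; nia.
have p2 : 0 <= j * (j - 1) by case: j {d1 d2 p1} => [[|j]|j]; nia.
have : (tri1 j).*2%:Z - (tri2 j).*2%:Z = j * (j + 1) - j * (j - 1).
  by rewrite d1 d2 !gez0_abs.
rewrite -mulrBr -!muln2; lia.
Qed.

Lemma tri_odd (j : int) : odd (absz j) = odd (tri1 j) (+) odd (tri2 j).
Proof. by have := tri_sub j; lia. Qed.

(* The derivative at x = 1 of the finite triple product with A = -x, B = -q/x,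
   computed with x = 1 + 'X and 1/x replaced by 1 - 'X. *)
Lemma finite_jacobi (R : comNzRingType) (q : R) m n :
  \sum_(k < (m.+1 + n).+1) gaussb q (m.+1 + n) k *
     ((k%:Z - n%:Z)%:~R * (-1) ^+ absz (k%:Z - n%:Z) * q ^+ tri2 (k%:Z - n%:Z)) =
  - (qfact q m * qfact q n).
Proof.
pose A : {poly R} := - (1 + 'X); pose B : {poly R} := - (q%:P * (1 - 'X)).
(* Only coefficients 0 and 1 matter: modulo ['X^2] the inverse of [1 + 'X] is [1 - 'X]. A [flat]
   polynomial is constant to first order. *)
pose flat (f : {poly R}) c := f`_0 = c /\ f`_1 = 0.
have coefM01 (f g : {poly R}) : ((f * g)`_0 = f`_0 * g`_0) * ((f * g)`_1 = f`_0 * g`_1 + f`_1 * g`_0).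
  by rewrite !coefM big_ord1 !big_ord_recl big_ord0 addr0.
have flatM f g c d : flat f c -> flat g d -> flat (f * g) (c * d).
  by move=> [f0 f1] [g0 g1]; rewrite /flat !coefM01 f0 f1 g0 g1 mulr0 mul0r addr0.
have flatD f g c d : flat f c -> flat g d -> flat (f + g) (c + d).
  by move=> [f0 f1] [g0 g1]; rewrite /flat !coefD f0 f1 g0 g1 addr0.
have flat1 : flat 1 1 by rewrite /flat !coef1.
have flatX f c i : flat f c -> flat (f ^+ i) (c ^+ i).
  by move=> fc; elim: i => [|i IH]; rewrite ?expr0 // !exprS; apply: flatM.
have flatN f c : flat f c -> flat (- f) (- c).
  by move=> [f0 f1]; rewrite /flat !coefN f0 f1 oppr0.
(* Here [A * B = q (1 - 'X^2)] has no linear term, so the Gaussian binomials do not contribute to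
   the derivative. *)
have p_flat : flat (A * B) q.
  by rewrite /flat !coefM01 !coefN !coefM01 !coefD !coefN !coefC ?coef1 !coefX /=; split; ring.
have gauss_flat N k : flat (gaussb (A * B) N k) (gaussb q N k).
  elim: N k => [|N IH] [|k] //=; first by rewrite /flat !coef0.
  by apply: flatD => //; apply: flatM => //; apply: flatX.
have powA i : (A ^+ i)`_0 = (-1) ^+ i /\ (A ^+ i)`_1 = i%:R * (-1) ^+ i.
  elim: i => [|i [IH0 IH1]]; first by rewrite !expr0 !coef1 mul0r.
  rewrite exprS !coefM01 IH0 IH1 !coefN !coefD !coef1 !coefX /= exprS -natr1.
  by split; ring.
have powB i : (B ^+ i)`_0 = (- q) ^+ i /\ (B ^+ i)`_1 = - (i%:R * (- q) ^+ i).
  elim: i => [|i [IH0 IH1]]; first by rewrite !expr0 !coef1 mul0r oppr0.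
  rewrite exprS !coefM01 IH0 IH1 !coefN !coefM01 !coefD !coefN !coefC ?coef1 !coefX /= exprS -natr1.
  by split; ring.
have := congr1 (fun f : {poly R} => f`_1) (finite_triple_product A B m.+1 n).
(* The first factor is [1 + A = - 'X], so the linear coefficient of the product is minus the
   constant coefficient of the rest. *)
rewrite big_ord_recl expr0 mulr1 -mulrA coefM01 !coefD !coefN !coefD !coef1 !coefX /=.
rewrite addr0 subrr mul0r !add0r mulN1r => E.
have rest : (\prod_(i < m) (1 + A * (A * B) ^+ lift ord0 i) *
             \prod_(i < n) (1 + B * (A * B) ^+ i))`_0 = qfact q m * qfact q n.
  rewrite -horner_coef0 hornerM !horner_prod /qfact.
  congr (_ * _); apply: eq_bigr => i _; rewrite horner_coef0 coefD coef1 coefM01 /=.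
    have [-> _] := flatX _ _ (lift ord0 i) p_flat.
    by rewrite coefN coefD coef1 coefX /= addr0 mulN1r ?lift0.
  have [-> _] := flatX _ _ i p_flat.
  by rewrite coefN coefM01 coefC coefB coef1 coefX /= subr0 mulr1 mulNr -exprS.
rewrite rest in E; rewrite E coef_sum; apply: eq_bigr => k _.
have [g0 g1] := gauss_flat (m.+1 + n)%N k.
rewrite coefM01 g0 g1 mul0r addr0; congr (_ * _).
move: (k%:Z - n%:Z) => j; rewrite /jterm coefM01.
have [-> ->] := powA (tri1 j); have [-> ->] := powB (tri2 j).
have <- : (tri1 j)%:R - (tri2 j)%:R = j%:~R :> R.
  by rewrite -[in RHS](tri_sub j) mulrzBr.
have <- : (-1) ^+ (tri1 j + tri2 j) = (-1) ^+ absz j :> R.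
  by rewrite -signr_odd oddD -tri_odd signr_odd.
rewrite exprD [(- q) ^+ _]exprNn; ring.
Qed.

(** * Theta series *)

Lemma perm_reindex (I J : eqType) (V : nmodType) (r : seq I) (s : seq J)
    (P : pred I) (Q : pred J) (h : J -> I) (F : I -> V) :
    uniq r -> uniq s -> {in Q &, injective h} ->
    (forall j, j \in s -> Q j -> h j \in r /\ P (h j)) ->
    (forall i, i \in r -> P i -> exists2 j, j \in s & Q j /\ h j = i) ->
  \sum_(i <- r | P i) F i = \sum_(j <- s | Q j) F (h j).
Proof.
move=> r_uniq s_uniq h_inj rs sr.
rewrite -big_filter -[RHS]big_filter -(big_map h xpredT) /=.
apply: perm_big; apply: uniq_perm.
- exact: filter_uniq.
- rewrite map_inj_in_uniq ?filter_uniq // => i j.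
  by rewrite !mem_filter => /andP[Qi _] /andP[Qj _]; apply: h_inj.
move=> i; rewrite mem_filter; apply/andP/mapP => [[Pi ri]|[j]].
  by have [j sj [Qj <-]] := sr _ ri Pi; exists j; rewrite // mem_filter Qj.
by rewrite mem_filter => /andP[Qj sj] ->; have [] := rs _ sj Qj.
Qed.

Lemma box_widen (V : nmodType) (P : pred int) (F : int -> V) n m :
    (forall x, P x -> (absz x <= n)%N /\ (absz x <= m)%N) ->
  \sum_(x <- box n | P x) F x = \sum_(x <- box m | P x) F x.
Proof.
move=> bound; apply: (perm_reindex (h := id)) => // [| |x|x]; rewrite ?box_uniq //.
  by rewrite !mem_box => _ Px; have [] := bound _ Px.
by rewrite !mem_box => _ Px; exists x; rewrite ?mem_box //; have [] := bound _ Px.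
Qed.

(** The series [sum c(x) t^(m x^2)] over all integers: for [m > 0], [m x^2 = N] implies [|x| <= N],
    so the box loses nothing. *)
Definition theta (c : int -> int) (m : nat) : fseries int :=
  Fseries (fun N => \sum_(x <- box N | (m * absz x ^ 2 == N)%N) c x).

Lemma thetaE c m N n : (0 < m)%N -> (N <= n)%N ->
  theta c m N = \sum_(x <- box n | (m * absz x ^ 2 == N)%N) c x.
Proof.
move=> m0 le_Nn; apply: box_widen => x /eqP Nx.
suff : (absz x <= N)%N by lia.
rewrite -Nx -mulnn; move: (absz x) => i; nia.
Qed.

Lemma eq_theta c c' m : c =1 c' -> theta c m = theta c' m.
Proof. by move=> cc; apply: fseriesP => N; apply: eq_bigr => x _; rewrite cc. Qed.

Lemma theta_odd0 c m : (forall x, c (- x) = - c x) -> theta c m = 0.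
Proof.
move=> c_odd; apply: fseriesP => N; rewrite scoef0 /=.
have E : \sum_(x <- box N | (m * absz x ^ 2 == N)%N) c x =
         \sum_(x <- box N | (m * absz x ^ 2 == N)%N) c (- x).
  apply: (perm_reindex (h := -%R)); rewrite ?box_uniq //; first by move=> x1 x2 _ _ /oppr_inj.
    by move=> x; rewrite !mem_box abszN.
  by move=> x; rewrite mem_box => le_xN Px; exists (- x); rewrite ?mem_box abszN ?opprK.
have := E; under [in RHS]eq_bigr do rewrite c_odd; rewrite sumrN.
by move/eqP; rewrite -subr_eq0 opprK -mulr2n mulrn_eq0 => /eqP.
Qed.

(** [chi3] and [chi4] are the odd quadratic characters of conductors 3 and 4; their product [chi12]
    is even. *)
Definition chi3 (x : int) : int :=
  if (x %% 3)%Z == 1 then 1 else if (x %% 3)%Z == 2 then -1 else 0.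
Definition chi4 (x : int) : int :=
  if (x %% 4)%Z == 1 then 1 else if (x %% 4)%Z == 3 then -1 else 0.
Definition chi12 (x : int) : int := chi4 x * chi3 x.
Definition sgp (x : int) : int := if (x %% 2)%Z == 0 then 1 else -1.
Definition oddz (x : int) : int := ((x %% 2)%Z == 1)%:R.

Lemma sgpE x : sgp x = (-1) ^+ absz x.
Proof.
have odd_mod : odd (absz x) = ((x %% 2)%Z != 0) by lia.
by rewrite -signr_odd odd_mod /sgp; case: eqP.
Qed.

Lemma scoef_intr_sXn (c : int) e N : (c%:~R * sX int ^+ e) N = if e == N then c else 0.
Proof.
have -> : (c%:~R * sX int ^+ e) N = c * (sX int ^+ e) N.
  by case: c => n; rewrite ?NegzE ?mulrNz ?mulNr ?scoefN ?mulNr scoef_nat natz.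
by rewrite sXnE /= eq_sym; case: eqP; rewrite ?mulr1 ?mulr0.
Qed.

Lemma scoef_sum_sX (r : seq int) (c : int -> int) (e : int -> nat) N :
  (\sum_(j <- r) (c j)%:~R * sX int ^+ e j) N = \sum_(j <- r | e j == N) c j.
Proof.
rewrite scoef_sum [RHS]big_mkcond; apply: eq_bigr => j _.
exact: scoef_intr_sXn.
Qed.

(* prod_(m >= 1) (1 - t^(e m)); locked because unification would otherwise
   expand powers of t with large exponents. *)
HB.lock Definition pinf (e : nat) : fseries int := Fseries (fun N => qfact (sX int ^+ e) N.+1 N).

Lemma sXn_coef0 e : (0 < e)%N -> (sX int ^+ e) 0%N = 0.
Proof. by move=> e0; rewrite sXnE /=; case: e e0. Qed.

Lemma pinfE e M n : (0 < e)%N -> (M <= n)%N -> eqst M (qfact (sX int ^+ e) n) (pinf e).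
Proof.
move=> e0 le_Mn N lt_NM; rewrite pinf.unlock /=.
by rewrite (qfact_stable (M := N.+1) (sXn_coef0 e0)) //; lia.
Qed.

HB.lock Definition eta (k : nat) : fseries int := sX int ^+ k * pinf (24 * k).

Lemma qfact_mod3 (T : comNzRingType) (q : T) n :
  qfact (q ^+ 3) n * ((\prod_(i < n) (1 - q * (q ^+ 3) ^+ i)) *
    (\prod_(i < n) (1 - q ^+ 2 * (q ^+ 3) ^+ i))) = qfact q (3 * n).
Proof.
elim: n => [|n IH]; first by rewrite muln0 /qfact !big_ord0 !mulr1.
have -> : (3 * n.+1 = (3 * n).+3)%N by lia.
rewrite !qfactS !big_ord_recr /= -IH -!exprM -exprD -exprS.
have -> : (2 + 3 * n = (3 * n).+2)%N by lia.
have -> : (3 * n.+1 = (3 * n).+3)%N by lia.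
ring.
Qed.

Lemma qfact_mod2 (T : comNzRingType) (q : T) n :
  qfact (q ^+ 2) n * \prod_(i < n) (1 - q * (q ^+ 2) ^+ i) = qfact q (2 * n).
Proof.
elim: n => [|n IH]; first by rewrite muln0 /qfact !big_ord0 !mulr1.
have -> : (2 * n.+1 = (2 * n).+2)%N by lia.
rewrite !qfactS !big_ord_recr /= -IH -!exprM -exprS.
have -> : (2 * n.+1 = (2 * n).+2)%N by lia.
ring.
Qed.

Lemma jterm_signed (T : comNzRingType) (s : int) (A B : T) j :
  s * s = 1 -> jterm (s%:~R * A) (s%:~R * B) j = (s ^+ absz j)%:~R * jterm A B j.
Proof.
move=> ss; rewrite /jterm !exprMn mulrACA -exprD; congr (_ * _).
rewrite -rmorphXn; congr (_%:~R).
have s2 i : s ^+ i = s ^+ odd i.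
  by rewrite -[in LHS](odd_double_half i) exprD -muln2 mulnC exprM expr2 ss expr1n mulr1.
by rewrite s2 oddD -tri_odd -s2.
Qed.

Lemma jterm_sX (s : int) a b j : s * s = 1 ->
  jterm (s%:~R * sX int ^+ a) (s%:~R * sX int ^+ b) j =
  (s ^+ absz j)%:~R * sX int ^+ (a * tri1 j + b * tri2 j).
Proof. by move=> ss; rewrite jterm_signed // /jterm -!exprM exprD. Qed.

Lemma triple_product_coef (s : int) a b e M n : s * s = 1 -> (0 < a + b)%N ->
    (M + M <= n)%N ->
  eqst (e + M) (sX int ^+ e * (qfact (sX int ^+ (a + b)) n *
       ((\prod_(i < n) (1 + s%:~R * sX int ^+ a * (sX int ^+ (a + b)) ^+ i)) *
        (\prod_(i < n) (1 + s%:~R * sX int ^+ b * (sX int ^+ (a + b)) ^+ i)))))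
    (Fseries (fun N => \sum_(j <- box n | (e + (a * tri1 j + b * tri2 j) == N)%N) s ^+ absz j)).
Proof.
move=> ss ab0 le_Mn N lt_N.
have AB : s%:~R * sX int ^+ a * (s%:~R * sX int ^+ b) = sX int ^+ (a + b).
  by rewrite mulrACA -intrM ss mul1r exprD.
have := @triple_product _ (s%:~R * sX int ^+ a) (s%:~R * sX int ^+ b) M n.
rewrite AB => /(_ (sXn_coef0 ab0) le_Mn) E.
rewrite [RHS]/= scoefXnM; case: ltnP => [lt_Ne|le_eN].
  by rewrite big1 // => j; lia.
rewrite E; last by lia.
rewrite (eq_bigr _ (fun j _ => jterm_sX a b j ss)).
rewrite scoef_sum_sX; apply: eq_bigl => j; lia.
Qed.

Lemma thetaN c m : theta (fun x => c (- x)) m = theta c m.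
Proof.
apply: fseriesP => N /=; symmetry.
apply: (perm_reindex (h := -%R)); rewrite ?box_uniq //; first by move=> x1 x2 _ _ /oppr_inj.
  by move=> x; rewrite !mem_box abszN.
by move=> x; rewrite mem_box => le_xN Px; exists (- x); rewrite ?mem_box abszN ?opprK.
Qed.

Lemma thetaD c c' m : theta (fun x => c x + c' x) m = theta c m + theta c' m.
Proof. by apply: fseriesP => N; rewrite scoefD /= big_split. Qed.

(** Used with [h] parametrising a residue class that contains the support of [c]; the growth
    condition on [h] keeps the same box sufficient. *)
Lemma theta_param c m (h : int -> int) N n :
    (0 < m)%N -> (N <= n)%N -> injective h ->
    (forall j, (absz j <= absz (h j))%N) ->
    (forall x, c x != 0 -> exists j, h j = x) ->
  theta c m N = \sum_(j <- box n | (m * absz (h j) ^ 2 == N)%N) c (h j).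
Proof.
move=> m0 le_Nn h_inj h_ge c_supp; rewrite (thetaE _ m0 le_Nn).
have bound x : (m * absz x ^ 2 == N)%N -> (absz x <= n)%N.
  move=> /eqP Nx; apply: leq_trans le_Nn.
  by rewrite -Nx -mulnn; move: (absz x) => i; nia.
rewrite (bigID (fun x => c x != 0)) /= [X in _ + X]big1 ?addr0; last first.
  by move=> x /andP[_] /negPn/eqP.
rewrite [RHS](bigID (fun j => c (h j) != 0)) /= [X in _ = _ + X]big1 ?addr0; last first.
  by move=> x /andP[_] /negPn/eqP.
apply: perm_reindex => // [| |j1 j2 _ _ /h_inj //|j _ /andP[Pj cj]|x _ /andP[Px cx]];
  rewrite ?box_uniq //.
  by rewrite mem_box bound // Pj.
have [j hj] := c_supp _ cx; exists j; last by rewrite hj Px cx.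
by rewrite mem_box (leq_trans (h_ge j)) // hj bound.
Qed.

Lemma sqr_absz (x : int) : (absz x ^ 2)%N%:Z = x * x.
Proof. by rewrite -mulnn -abszM gez0_abs //; nia. Qed.

Lemma tri_doublez (j : int) :
  ((tri1 j).*2%:Z = j * (j + 1)) * ((tri2 j).*2%:Z = j * (j - 1)).
Proof.
rewrite !tri_double; split; rewrite gez0_abs //; case: j => [[|j]|j]; nia.
Qed.

Lemma tri_add j : (tri1 j + tri2 j = absz j ^ 2)%N.
Proof. by have [d1 d2] := tri_doublez j; have := sqr_absz j; lia. Qed.

(** Euler's pentagonal number theorem: the triple product with [A = -t^(24 k)] and
    [B = -t^(48 k)]. *)
Lemma theta_eta k : (0 < k)%N -> theta chi12 k = 2%:R * eta k.
Proof.
(* [chi12] is even and lives on the classes 1 and 5 modulo 6, so half of the series comes from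
   [x = 6 j - 1]. *)
move=> k0; pose c x := if (x %% 6)%Z == 5 then chi12 x else 0.
have -> : theta chi12 k = theta (fun x => c x + c (- x)) k.
  by apply: eq_theta => x; rewrite /c /chi12 /chi3 /chi4; do !case: ifP; lia.
rewrite thetaD thetaN -mulr2n [RHS]mulr_natl; congr (_ *+ 2).
apply: eqst_eq => M N lt_NM.
have ss : (-1 : int) * -1 = 1 by [].
have ab : (0 < 24 * k + 48 * k)%N by lia.
have lt_N : (N < k + M)%N by lia.
have := triple_product_coef ss ab (leqnn (M + M)) lt_N.
have N1 (f : fseries int) : (-1)%:~R * f = - f by rewrite mulrN1z mulN1r.
have -> : (24 * k + 48 * k = 24 * k * 3)%N by lia.
have -> : (48 * k = 24 * k * 2)%N by lia.
rewrite !N1 !(exprM _ (24 * k)).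
under eq_bigr do rewrite mulNr; under [X in _ * (_ * (_ * X))]eq_bigr do rewrite mulNr.
rewrite qfact_mod3 => E.
rewrite eta.unlock (eqstM (@eqst_refl _ N.+1 _) (eqst_sym (pinfE (n := 3 * (M + M)) _ _)) (ltnSn N));
  try lia.
rewrite E.
have le_NM : (N <= M + M)%N by lia.
rewrite (theta_param (h := fun j => 6 * j - 1) k0 le_NM); first last.
- move=> x; rewrite /c; case: ifP => // x5 _; exists ((x + 1) %/ 6)%Z; lia.
- by move=> j; lia.
- by move=> i j; lia.
rewrite [RHS]/=; apply: eq_big => [j|j _].
  have -> : (absz (6 * j - 1)%R ^ 2 = 1 + 24 * tri1 j + 48 * tri2 j)%N.
    by have [d1 d2] := tri_doublez j; have := sqr_absz (6 * j - 1); lia.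
  by congr (_ == _); lia.
rewrite /c /chi12 /chi3 /chi4 -sgpE /sgp; do !case: ifP; lia.
Qed.

(** Jacobi's identity for the cube, the limit of [finite_jacobi]. *)
Lemma theta_jacobi k : (0 < k)%N ->
  theta (fun x => chi4 x * x) (3 * k) = 2%:R * eta k ^+ 3.
Proof.
move=> k0.
(* Since [chi4] is odd the extra term vanishes; at [x = 2 j - 1] the new weight is [2 j], as in the
   differentiated triple product. *)
have -> : theta (fun x => chi4 x * x) (3 * k) = theta (fun x => chi4 x * (x + 1)) (3 * k).
  rewrite [RHS](@eq_theta _ (fun x => chi4 x * x + chi4 x)) => [|x]; last by ring.
  rewrite thetaD (@theta_odd0 chi4) ?addr0 // => x.
  by rewrite /chi4; do !case: ifP; lia.
apply: eqst_eq => M N lt_NM; pose q := sX int ^+ (24 * k).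
have q0 : q 0%N = 0 by apply: sXn_coef0; lia.
pose w (j : int) := j%:~R * (-1) ^+ absz j * q ^+ tri2 j.
have wE j : w j = (j * (-1) ^+ absz j)%:~R * sX int ^+ (24 * k * tri2 j).
  by rewrite /w -exprM intrM rmorphXn rmorphN1.
have w0 (j : int) : (M < absz j)%N -> eqst M (w j) 0.
  move=> lt_Mj; rewrite /w; apply/eqst_mul0/eqst_expr => //.
  by have [d1 d2] := tri_doublez j; nia.
have le_Mn : (M + M <= (M + M).+1)%N by [].
have := triple_limit q0 le_Mn w0.
rewrite addSn (finite_jacobi q (M + M) (M + M).+1) mulrN => E.
have le_Nn : (N <= (M + M).+1)%N by lia.
have k3 : (0 < 3 * k)%N by lia.
rewrite (theta_param (h := fun j => 2 * j - 1) k3 le_Nn); first last.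
- move=> x cx; exists ((x + 1) %/ 2)%Z.
  by move: cx; rewrite /chi4; do !case: ifP; lia.
- by move=> j; lia.
- by move=> i j; lia.
have -> : eta k ^+ 3 = sX int ^+ (3 * k) * (pinf (24 * k) * (pinf (24 * k) * pinf (24 * k))).
  by rewrite eta.unlock exprMn -exprM mulnC !exprS expr0 mulr1.
rewrite scoef_nat.
have P n : (M <= n)%N -> eqst M (pinf (24 * k)) (qfact q n).
  by move=> le_n; apply/eqst_sym/pinfE => //; lia.
have E2 : eqst M (pinf (24 * k) * (pinf (24 * k) * pinf (24 * k)))
                 (- \sum_(j <- box (M + M).+1) w j).
  move=> i lt_iM; rewrite scoefN -E // scoefN opprK.
  by apply: (eqstM (P _ _) (eqstM (P _ _) (P _ _))) => //; lia.
rewrite (eqstM (@eqst_refl _ M (sX int ^+ (3 * k))) E2) // mulrN scoefN mulr_sumr.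
rewrite (eq_bigr (fun j => (j * (-1) ^+ absz j)%:~R * sX int ^+ (3 * k + 24 * k * tri2 j))).
  2: by move=> j _; rewrite wE exprD; ring.
rewrite scoef_sum_sX -sumrN mulr_sumr; apply: eq_big => [j|j _].
  have -> : (absz (2 * j - 1)%R ^ 2 = 1 + 8 * tri2 j)%N.
    by have [d1 d2] := tri_doublez j; have := sqr_absz (2 * j - 1); lia.
  by congr (_ == _); lia.
rewrite -sgpE natz /chi4 /sgp; do !case: ifP; lia.
Qed.

(** Gauss's product for theta_4; [theta_one] and [theta_oddz] are the analogues for theta_3 and
    theta_2. *)
Lemma theta_sgp : theta sgp 24 * eta 2 = eta 1 ^+ 2.
Proof.
rewrite eta.unlock -[(24 * 2)%N]/48%N -[(24 * 1)%N]/24%N expr1.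
have R (x t p1 p2 : fseries int) :
    t * p2 = p1 ^+ 2 -> t * (x ^+ 2 * p2) = (x * p1) ^+ 2.
  by move=> E; rewrite exprMn -E; ring.
apply: R.
apply: eqst_eq => M; set n := (M + M)%N; set q := sX int ^+ 24.
have ss : (-1 : int) * -1 = 1 by [].
have le_Mn : (M + M <= n)%N by [].
have := @triple_product_coef (-1) 24 24 0 M n ss isT le_Mn.
rewrite expr0 mul1r add0n mulrN1z -[(24 + 24)%N]/(24 * 2)%N exprM mulN1r -/q.
under eq_bigr do rewrite mulNr.
set C := \prod_(i < n) _ => E.
have CE := qfact_mod2 q n; rewrite -/C in CE.
have P48 : eqst M (pinf 48) (qfact (q ^+ 2) n).
  by rewrite /q -exprM; apply/eqst_sym/pinfE => //; lia.
have P24 : eqst M (qfact q (2 * n)) (pinf 24) by apply: pinfE => //; lia.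
have T : eqst M (theta sgp 24) (qfact (q ^+ 2) n * (C * C)).
  move=> N lt_NM; rewrite E // [RHS]/= (@thetaE _ _ _ n) //; last by lia.
  apply: eq_big => [j|j _]; last exact: sgpE.
  by rewrite -tri_add mulnDr.
apply: eqst_trans (eqstM T P48) _.
have R1 (a c : fseries int) : a * (c * c) * a = a * c * (a * c) by ring.
by rewrite R1 CE expr2; apply: (eqstM P24 P24).
Qed.

Lemma theta_one : theta (fun _ => 1) 24 * (eta 1 ^+ 2 * eta 4 ^+ 2) = eta 2 ^+ 5.
Proof.
rewrite eta.unlock -[(24 * 2)%N]/48%N -[(24 * 1)%N]/24%N -[(24 * 4)%N]/96%N expr1.
have R (x t p1 p2 p4 : fseries int) : t * (p1 ^+ 2 * p4 ^+ 2) = p2 ^+ 5 ->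
    t * ((x * p1) ^+ 2 * (x ^+ 4 * p4) ^+ 2) = (x ^+ 2 * p2) ^+ 5.
  by move=> E; rewrite [RHS]exprMn -E; ring.
apply: R.
apply: eqst_eq => M; set n := (M + M)%N; set q := sX int ^+ 24.
have ss : (1 : int) * 1 = 1 by [].
have le_Mn : (M + M <= n)%N by [].
have := @triple_product_coef 1 24 24 0 M n ss isT le_Mn.
rewrite expr0 mul1r add0n -[(24 + 24)%N]/(24 * 2)%N exprM mul1r -/q.
set B := \prod_(i < n) _ => E.
pose C := \prod_(i < n) (1 - q * (q ^+ 2) ^+ i).
pose C2 := \prod_(i < n) (1 - q ^+ 2 * (q ^+ 2 ^+ 2) ^+ i).
(* The factors [1 - q^(2i+1)] and [1 + q^(2i+1)] combine to the same odd product in [q^2]. *)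
have CB : C * B = C2.
  have R1 (x : fseries int) : (1 - x) * (1 + x) = 1 - x ^+ 2 by ring.
  rewrite -big_split /=; apply: eq_bigr => i _.
  by rewrite R1 exprMn [_ ^+ i ^+ 2]exprAC.
have CE : qfact (q ^+ 2) n * C = qfact q (2 * n) := qfact_mod2 q n.
have CE2 : qfact (q ^+ 2 ^+ 2) n * C2 = qfact (q ^+ 2) (2 * n) := qfact_mod2 (q ^+ 2) n.
have P24 : eqst M (pinf 24) (qfact q (2 * n)) by apply/eqst_sym/pinfE => //; lia.
have P48 m : (M <= m)%N -> eqst M (qfact (q ^+ 2) m) (pinf 48).
  by move=> le_m; rewrite /q -exprM; apply: pinfE.
have P96 : eqst M (pinf 96) (qfact (q ^+ 2 ^+ 2) n).
  by rewrite /q -!exprM; apply/eqst_sym/pinfE => //; lia.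
have T : eqst M (theta (fun _ => 1) 24) (qfact (q ^+ 2) n * (B * B)).
  move=> N lt_NM; rewrite E // [RHS]/= (@thetaE _ _ _ n) //; last by lia.
  apply: eq_big => [j|j _]; last by rewrite expr1n.
  by rewrite -tri_add mulnDr.
rewrite [pinf 24 ^+ 2]expr2 [pinf 96 ^+ 2]expr2 !exprS expr0 mulr1.
apply: eqst_trans (eqstM T (eqstM (eqstM P24 P24) (eqstM P96 P96))) _.
have R1 (f h c d e r u : fseries int) : f * c = r -> c * d = e -> h * e = u ->
    f * (d * d) * (r * r * (h * h)) = f * (f * (f * (u * u))).
  by move=> <- <- <-; ring.
rewrite (R1 _ _ _ _ _ _ _ CE CB CE2).
by do !apply: eqstM; apply: P48; lia.
Qed.

Lemma theta_oddz : theta oddz 6 * eta 2 = 2%:R * eta 4 ^+ 2.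
Proof.
rewrite eta.unlock -[(24 * 2)%N]/48%N -[(24 * 4)%N]/96%N.
apply: eqst_eq => M; set n := (M + M)%N; set q := sX int ^+ 48.
have ss : (1 : int) * 1 = 1 by [].
have le_Mn : (M + M <= n)%N by [].
have := @triple_product_coef 1 0 48 6 M n ss isT le_Mn.
rewrite expr0 add0n !mul1r -/q.
under eq_bigr do rewrite mul1r.
set G := \prod_(i < n) (1 + q ^+ i); set B := \prod_(i < n) _ => E.
have T : eqst M (theta oddz 6) (sX int ^+ 6 * (qfact q n * (G * B))).
  move=> N lt_NM; rewrite E ?[RHS]/=; last by lia.
  have le_Nn : (N <= n)%N by lia.
  rewrite (theta_param (h := fun j => 2 * j - 1) _ le_Nn) //; first last.
  - by move=> x cx; exists ((x + 1) %/ 2)%Z; move: cx; rewrite /oddz; case: eqP; lia.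
  - by move=> j; lia.
  - by move=> i j; lia.
  apply: eq_big => [j|j _].
    have -> : (absz (2 * j - 1)%R ^ 2 = 1 + 8 * tri2 j)%N.
      by have [d1 d2] := tri_doublez j; have := sqr_absz (2 * j - 1); lia.
    by congr (_ == _); lia.
  by rewrite expr1n /oddz; case: eqP; lia.
have q0 : q 0%N = 0 by apply: sXn_coef0.
have Q1 : eqst M (pinf 48) (qfact q n * (1 + q ^+ n)).
  rewrite mulrDr mulr1 -[pinf 48]addr0; apply: eqstD.
    by apply/eqst_sym/pinfE => //; lia.
  by apply/eqst_sym/eqst_mul0/eqst_expr => //; lia.
(* With [a = 0] the product [G] starts with [1 + q^0 = 2]; shifting the index turns the rest into
   [B], and the leftover [1 + q^n] is 1 modulo [t^M]. *)
have GB : G * (1 + q ^+ n) = 2%:R * B.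
  rewrite -[G * _](big_ord_recr n (fun i => 1 + q ^+ i)) big_ord_recl expr0.
  by congr (_ * _); apply: eq_bigr => i _; rewrite lift0 exprS.
have BE : qfact q n * B = qfact (q ^+ 2) n.
  rewrite /qfact -big_split; apply: eq_bigr => i _ /=.
  have R1 (x : fseries int) : (1 - x) * (1 + x) = 1 - x ^+ 2 by ring.
  by rewrite -exprS R1 exprAC.
have P96 : eqst M (qfact (q ^+ 2) n) (pinf 96).
  by rewrite /q -!exprM; apply: pinfE => //; lia.
apply: eqst_trans (eqstM T (eqstM (@eqst_refl _ M (sX int ^+ 2)) Q1)) _.
have R (s6 s2 a c d e : fseries int) : c * e = 2%:R * d ->
    s6 * (a * (c * d)) * (s2 * (a * e)) = 2%:R * (s6 * s2 * (a * d * (a * d))).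
  move=> ce; transitivity (s6 * s2 * (a * a * d) * (c * e)); first by ring.
  by rewrite ce; ring.
rewrite (R _ _ _ _ _ _ GB) BE -exprD.
rewrite [X in eqst _ _ X](_ : _ = 2%:R * (sX int ^+ (6 + 2) * (pinf 96 * pinf 96))); last first.
  by rewrite exprMn -exprM -expr2.
by do !apply: eqstM => //; apply: eqst_refl.
Qed.

(** * Rotations of binary lattice sums *)

Definition box2 n : seq (int * int) := [seq (x, y) | x <- box n, y <- box n].

Lemma mem_box2 n v : (v \in box2 n) = (absz v.1 <= n)%N && (absz v.2 <= n)%N.
Proof.
rewrite -!mem_box; case: v => x y; apply/allpairsP/andP => /= [[[a b] /= [ha hb [-> ->]]]|[hx hy]] //.
by exists (x, y).
Qed.

Lemma box2_uniq n : uniq (box2 n).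
Proof. by apply: allpairs_uniq; rewrite ?box_uniq // => -[a b] [c d] _ _. Qed.

(* Coefficient at t^N of the sum of f(x, y) t^(m x^2 + m' y^2) over the integer
   points satisfying P; for m, m' > 0 all points of norm N lie in the box. *)
Definition latsum (m m' N : nat) (P : pred (int * int)) (f : int * int -> int) : int :=
  \sum_(v <- box2 N | P v && (m%:Z * (v.1 * v.1) + m'%:Z * (v.2 * v.2) == N%:Z)) f v.

(** Change of variables [h] between two positive definite forms: equality of the forms matches the
    level sets, and definiteness gives the box bounds. *)
Lemma latsum_reindex m m' p p' N (P Q : pred (int * int)) (h : int * int -> int * int) f g :
    (0 < m)%N -> (0 < m')%N -> (0 < p)%N -> (0 < p')%N ->
    {in Q &, injective h} ->
    (forall w, Q w -> P (h w) /\ f (h w) = g w /\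
       m%:Z * ((h w).1 * (h w).1) + m'%:Z * ((h w).2 * (h w).2) =
       p%:Z * (w.1 * w.1) + p'%:Z * (w.2 * w.2)) ->
    (forall v, P v -> exists2 w, Q w & h w = v) ->
  latsum m m' N P f = latsum p p' N Q g.
Proof.
move=> m0 m'0 p0 p'0 h_inj hQ hP.
have bound q q' (v : int * int) : (0 < q)%N -> (0 < q')%N ->
    q%:Z * (v.1 * v.1) + q'%:Z * (v.2 * v.2) = N%:Z -> v \in box2 N.
  by case: v => x y /= q0 q'0 E; rewrite mem_box2 /=; nia.
rewrite /latsum (perm_reindex (h := h) (s := box2 N) (Q := fun w => Q w &&
    (p%:Z * (w.1 * w.1) + p'%:Z * (w.2 * w.2) == N%:Z))) ?box2_uniq //.
- by apply: eq_bigr => w /andP[/hQ[_ [-> _]]].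
- by move=> i j /andP[Qi _] /andP[Qj _]; apply: h_inj.
- move=> w _ /andP[/hQ[Pw [_ E]] /eqP wN].
  by rewrite Pw E wN eqxx (bound m m') // E wN.
- move=> v _ /andP[/hP[w Qw <-] /eqP].
  have [_ [_ ->]] := hQ _ Qw => wN.
  by exists w; rewrite ?Qw ?wN ?eqxx // (bound p p').
Qed.

Lemma latsum_ext m m' N (P : pred (int * int)) (f g : int * int -> int) : (forall v, P v -> f v = g v) ->
  latsum m m' N P f = latsum m m' N P g.
Proof. by move=> fg; apply: eq_bigr => v /andP[/fg]. Qed.

Lemma latsum_split m m' N (Q P : pred (int * int)) f :
  latsum m m' N P f =
  latsum m m' N (fun v => P v && Q v) f + latsum m m' N (fun v => P v && ~~ Q v) f.
Proof.
rewrite /latsum (bigID Q); congr (_ + _);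
  by apply: eq_bigl => v; rewrite -!andbA; congr (_ && _); rewrite andbC.
Qed.

Lemma latsumD m m' N P (f g : int * int -> int) :
  latsum m m' N P (fun v => f v + g v) = latsum m m' N P f + latsum m m' N P g.
Proof. exact: big_split. Qed.

Lemma latsumZ m m' N P k (f : int * int -> int) :
  latsum m m' N P (fun v => k * f v) = k * latsum m m' N P f.
Proof. by rewrite /latsum mulr_sumr. Qed.

Lemma latsum0 m m' N (P : pred (int * int)) (f : int * int -> int) : (forall v, P v -> f v = 0) -> latsum m m' N P f = 0.
Proof. by move=> f0; apply: big1 => v /andP[/f0]. Qed.

Lemma latsum_odd0 m m' N (P : pred (int * int)) f (h : int * int -> int * int) :
    (0 < m)%N -> (0 < m')%N -> involutive h ->
    (forall w, ((h w).1 * (h w).1 = w.1 * w.1) /\ ((h w).2 * (h w).2 = w.2 * w.2)) ->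
    (forall w, P w -> P (h w) /\ f (h w) = - f w) ->
  latsum m m' N P f = 0.
Proof.
move=> m0 m'0 hK hsq hP; have hI := inv_inj hK.
have : latsum m m' N P f = latsum m m' N P (fun v => -1 * f v).
  apply: (@latsum_reindex _ _ _ _ _ _ _ h) => // [v w _ _ /hI //|w Pw|v Pv].
    have [Phw fhw] := hP _ Pw; have [-> ->] := hsq w.
    by rewrite fhw mulN1r.
  by exists (h v); rewrite ?hK //; case: (hP _ Pv).
by rewrite latsumZ; lia.
Qed.

Lemma theta_trunc c m N : (0 < m)%N ->
  eqst N.+1 (theta c m) (\sum_(x <- box N) (c x)%:~R * sX int ^+ (m * absz x ^ 2)).
Proof.
by move=> m0 n; rewrite ltnS => le_nN; rewrite scoef_sum_sX (thetaE _ m0 le_nN).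
Qed.

Lemma theta_mul c c' m m' N : (0 < m)%N -> (0 < m')%N ->
  (theta c m * theta c' m') N = latsum m m' N xpredT (fun v => c v.1 * c' v.2).
Proof.
move=> m0 m'0.
rewrite (eqstM (theta_trunc (N := N) c m0) (theta_trunc (N := N) c' m'0)) //.
rewrite mulr_suml scoef_sum /latsum [RHS]big_mkcond /box2 big_allpairs.
apply: eq_bigr => x _; rewrite mulr_sumr scoef_sum; apply: eq_bigr => y _.
rewrite mulrACA -intrM -exprD scoef_intr_sXn -!sqr_absz.
by congr (if _ then _ else _); lia.
Qed.

Lemma sder_theta c m : sder (theta c m) = theta (fun x => m%:Z * (x * x) * c x) m.
Proof.
apply: fseriesP => N; rewrite sderE /= mulr_sumr; apply: eq_bigr => x /eqP <-.
by rewrite natz PoszM sqr_absz.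
Qed.

Definition evenz (x : int) := (x %% 2)%Z == 0.
Definition odd_pair (v : int * int) := ~~ evenz v.1 && ~~ evenz v.2.
Definition same_parity (v : int * int) := evenz (v.1 + v.2).

(* Multiplication by twice a primitive cube root of unity on n + m sqrt(-3). *)
Definition rot3 (v : int * int) : int * int := (- v.1 - 3 * v.2, v.1 - v.2).

Lemma pair_eq2 (a b c d : int) : a = c -> b = d -> (a, b) = (c, d).
Proof. by move=> -> ->. Qed.

Lemma chi3_odd_sum N (P : pred (int * int)) (o : int * int -> int) :
    (forall n m, P (n, - m) = P (n, m)) -> (forall n m, o (n, - m) = - o (n, m)) ->
  latsum 8 24 N P (fun v => chi3 v.1 * o v) = 0.
Proof.
move=> PN oN; apply: (@latsum_odd0 _ _ _ _ _ (fun v => (v.1, - v.2))) => //.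
- by case=> x y; rewrite /= opprK.
- by move=> [x y] /=; lia.
- by move=> [x y] /=; rewrite PN oN => ->; split; rewrite ?mulrN.
Qed.

(* Odd pairs with x + y divisible by 4 are the images of the pairs of opposite
   parity under rot3; y -> -y exchanges them with the other odd pairs. *)
Lemma odd_pair_sum N (F : int * int -> int) :
    (forall x y, F (x, - y) = F (x, y)) ->
  latsum 2 6 N odd_pair F =
  2 * latsum 8 24 N (fun v => ~~ same_parity v) (fun v => F (rot3 v)).
Proof.
move=> FN; pose Q v := ((v.1 + v.2) %% 4)%Z == 0.
rewrite (latsum_split _ _ _ Q).
have -> : latsum 2 6 N (fun v => odd_pair v && ~~ Q v) F =
          latsum 2 6 N (fun v => odd_pair v && Q v) F.
  apply: (@latsum_reindex _ _ _ _ _ _ _ (fun v => (v.1, - v.2))) => //.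
  - by move=> [a b] [c d] _ _ /= [-> /oppr_inj ->].
  - by move=> [x y] /=; rewrite /odd_pair /evenz /Q FN /=; split; lia.
  - move=> [x y] /= xy; exists (x, - y); last by rewrite /= opprK.
    by move: xy; rewrite /odd_pair /evenz /Q /=; lia.
have -> : latsum 2 6 N (fun v => odd_pair v && Q v) F =
          latsum 8 24 N (fun v => ~~ same_parity v) (fun v => F (rot3 v)).
  apply: (@latsum_reindex _ _ _ _ _ _ _ rot3) => //.
  - by move=> [a b] [c d] _ _; rewrite /rot3 /= => -[h1 h2]; apply: pair_eq2; lia.
  - move=> [n m]; rewrite /odd_pair /evenz /Q /same_parity /evenz /rot3 /= => par.
    by split; [lia | split=> //; ring].
  - move=> [x y]; rewrite /odd_pair /evenz /Q /= => xy.
    exists (y - ((x + y) %/ 4)%Z, - ((x + y) %/ 4)%Z).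
      by rewrite /same_parity /evenz /=; lia.
    by rewrite /rot3 /=; apply: pair_eq2; lia.
lia.
Qed.

(* On pairs of equal parity a cube root of unity acts on the lattice, and the sum
   equals - k'/k times itself up to terms odd in the second variable. *)
Lemma same_parity_sum0 N (f o : int * int -> int) (k k' : int) :
    k + k' != 0 ->
    (forall n m, f (2 * n, 2 * m) = k * f (n, m)) ->
    (forall n m, f (rot3 (n, m)) = - k' * f (n, m) + o (n, m)) ->
    (forall n m, o (n, - m) = - o (n, m)) ->
  latsum 8 24 N same_parity (fun v => chi3 v.1 * f v) = 0.
Proof.
move=> kk f2 frot oN.
(* Half of [rot3], that is, multiplication by a cube root of unity, integral on pairs of equal
   parity. It preserves [chi3] of the first coordinate, as [(-n - 3 m) / 2] is [n] modulo 3. *)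
pose h (v : int * int) := (((- v.1 - 3 * v.2) %/ 2)%Z, ((v.1 - v.2) %/ 2)%Z).
have hE n m : same_parity (n, m) -> rot3 (n, m) = (2 * (h (n, m)).1, 2 * (h (n, m)).2).
  by rewrite /same_parity /evenz /rot3 /h /= => par; apply: pair_eq2; lia.
have parN n m : same_parity (n, - m) = same_parity (n, m).
  by rewrite /same_parity /evenz /=; lia.
have E : latsum 8 24 N same_parity (fun v => chi3 v.1 * (k * f v)) =
         latsum 8 24 N same_parity (fun v => chi3 v.1 * f (rot3 v)).
  apply: (@latsum_reindex _ _ _ _ _ _ _ h) => //.
  - move=> [a b] [c d] /(hE a b) + /(hE c d).
    rewrite /rot3 /= => -[e1 e2] [e3 e4] [h1 h2].
    by apply: pair_eq2; lia.
  - move=> [n m] par; have := hE _ _ par; case: (h (n, m)) => a b /= r.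
    rewrite r f2; move: par r; rewrite /same_parity /evenz /rot3 /= => par [e1 e2].
    split; first lia; split; last nia.
    by congr (_ * _); rewrite /chi3; do !case: ifP; lia.
  - move=> [n m] par; exists (((- n + 3 * m) %/ 2)%Z, ((- n - m) %/ 2)%Z).
      by move: par; rewrite /same_parity /evenz /=; lia.
    by move: par; rewrite /same_parity /evenz /h /= => par; apply: pair_eq2; lia.
have E2 : latsum 8 24 N same_parity (fun v => chi3 v.1 * f (rot3 v)) =
  - k' * latsum 8 24 N same_parity (fun v => chi3 v.1 * f v).
  rewrite -latsumZ -[RHS]addr0 -(chi3_odd_sum N parN oN) -latsumD.
  by apply: latsum_ext => -[n m] _ /=; rewrite frot; ring.
have E1 : latsum 8 24 N same_parity (fun v => chi3 v.1 * (k * f v)) =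
  k * latsum 8 24 N same_parity (fun v => chi3 v.1 * f v).
  by rewrite -latsumZ; apply: latsum_ext => v _; ring.
move: E; rewrite E1 E2 => /eqP; rewrite -subr_eq0 -mulrBl opprK mulf_eq0 (negbTE kk).
by move/eqP.
Qed.

(* Up to the factor 2, these are eta_2^5 / eta_1^2, eta_1^2 eta_4^2 / eta_2 and
   eta_2^5 / eta_4^2. *)
Definition thetaW := theta (fun x => - (sgp x * chi3 x * x)) 8.
Definition thetaW' := theta (fun x => chi3 x * x) 8.
Definition thetaV := theta (fun x => oddz x * chi3 x * x) 2.

Definition diff_parity (v : int * int) := ~~ same_parity v.

(* 1/32 of the real part of (2n + 2m sqrt(-3))^5 *)
Definition re5 (v : int * int) : int :=
  v.1 * (v.1 ^+ 4 - 30 * v.1 ^+ 2 * v.2 ^+ 2 + 45 * v.2 ^+ 4).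
(* 1/sqrt(3) of the imaginary part of (x + y sqrt(-3))^5 *)
Definition im5 (v : int * int) : int :=
  v.2 * (5 * v.1 ^+ 4 - 30 * v.1 ^+ 2 * v.2 ^+ 2 + 9 * v.2 ^+ 4).

Lemma same_parity_re1 N : latsum 8 24 N same_parity (fun v => chi3 v.1 * v.1) = 0.
Proof.
apply: (@same_parity_sum0 N (fun v => v.1) (fun v => - 3 * v.2) 2 1) => // n m;
  by rewrite /rot3 /=; ring.
Qed.

(** The constants are [2^5 = 32] and minus the real part of [(2 w)^5 = 32 w^2], with [w] a primitive
    cube root of unity. *)
Lemma same_parity_re5 N : latsum 8 24 N same_parity (fun v => chi3 v.1 * re5 v) = 0.
Proof.
apply: (@same_parity_sum0 N re5 (fun v => re5 (rot3 v) + 16 * re5 v) 32 16) => // n m;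
  by rewrite /re5 /rot3 /=; ring.
Qed.

Lemma diff_parity_odd0 N (o : int * int -> int) :
    (forall n m, o (n, - m) = - o (n, m)) ->
  latsum 8 24 N diff_parity (fun v => chi3 v.1 * o v) = 0.
Proof.
move=> oN; apply: chi3_odd_sum => // n m.
by rewrite /diff_parity /same_parity /evenz /=; lia.
Qed.

Lemma latsum_splitT (Q : pred (int * int)) m m' N f :
  latsum m m' N xpredT f = latsum m m' N Q f + latsum m m' N (fun v => ~~ Q v) f.
Proof. exact: latsum_split. Qed.

Lemma odd_pair_supp N (f : int * int -> int) :
    (forall v, ~~ odd_pair v -> f v = 0) ->
  latsum 2 6 N xpredT f = latsum 2 6 N odd_pair f.
Proof.
by move=> f0; rewrite (latsum_splitT odd_pair) [X in _ + X]latsum0 ?addr0.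
Qed.

(** For [(x, y) = rot3 (n, m)], [x = -n] modulo 3 and [x + y = -4 m]; opposite parity of [n] and [m]
    makes [x] and [y] odd. *)
Lemma rot3_chi v : diff_parity v ->
  (chi12 (rot3 v).1 * chi4 (rot3 v).2 = chi3 v.1) /\ oddz (rot3 v).1 * chi3 (rot3 v).1 = - chi3 v.1
   /\ oddz (rot3 v).2 = 1.
Proof.
case: v => n m; rewrite /diff_parity /same_parity /evenz /rot3 /= => par.
rewrite /chi12 (_ : chi3 (- n - 3 * m) = - chi3 n); last first.
  by rewrite /chi3; do !case: ifP; lia.
have [-> ->] : oddz (- n - 3 * m) = 1 /\ oddz (n - m) = 1.
  by rewrite /oddz; case: eqP; case: eqP; lia.
have E : chi4 (- n - 3 * m) * chi4 (n - m) = -1.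
  by rewrite /chi4; do !case: ifP; lia.
split; last by rewrite mul1r.
by rewrite mulrAC E; ring.
Qed.

(** Carries an Euler series times a Jacobi series from the form [2 x^2 + 6 y^2] to [8 n^2 + 24 m^2];
    the part [o] of the rotated weight cancels under [m -> -m]. *)
Lemma chi12_chi4_sum N (g re o : int * int -> int) c :
    (forall x y, g (x, - y) = - g (x, y)) ->
    (forall n m, g (rot3 (n, m)) = c * re (n, m) + o (n, m)) ->
    (forall n m, o (n, - m) = - o (n, m)) ->
  latsum 2 6 N xpredT (fun v => chi12 v.1 * chi4 v.2 * g v) =
  2 * c * latsum 8 24 N diff_parity (fun v => chi3 v.1 * re v).
Proof.
move=> gN grot oN; rewrite odd_pair_supp => [|[x y]]; last first.
  rewrite /odd_pair /chi12 /chi4 /evenz /= => xy.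
  by do !case: ifP; rewrite ?mul0r ?mulr0 ?mul0r //; lia.
rewrite odd_pair_sum => [|x y]; last first.
  by rewrite /= gN /chi4; do !case: ifP; rewrite ?mulr0 ?mul0r ?mulr1 ?mulrN ?mulNr ?mulr1 ?opprK //; lia.
rewrite -mulrA; congr (_ * _); rewrite -latsumZ.
rewrite -[RHS]addr0 -(diff_parity_odd0 N oN) -latsumD.
by apply: latsum_ext => -[n m] /rot3_chi[-> _]; rewrite grot /=; ring.
Qed.

Lemma sgpM n m : sgp n * sgp m = if same_parity (n, m) then 1 else -1.
Proof. by rewrite /sgp /same_parity /evenz /=; do !case: ifP; lia. Qed.

(** The signs separate the two parity classes, and the class of equal parity sums to zero by
    hypothesis. *)
Lemma sgp_chi3_sum N (re : int * int -> int) :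
    latsum 8 24 N same_parity (fun v => chi3 v.1 * re v) = 0 ->
  latsum 8 24 N xpredT (fun v => - (sgp v.1 * sgp v.2 * chi3 v.1 * re v)) =
  latsum 8 24 N diff_parity (fun v => chi3 v.1 * re v).
Proof.
move=> re0; rewrite (latsum_splitT same_parity).
rewrite [X in X + _](_ : _ = -1 * latsum 8 24 N same_parity (fun v => chi3 v.1 * re v)).
  rewrite re0 mulr0 add0r; apply: latsum_ext => -[n m] /negbTE par /=.
  by rewrite sgpM par; ring.
by rewrite -latsumZ; apply: latsum_ext => -[n m] par; rewrite sgpM par /=; ring.
Qed.

(** Up to scale both sides are the sum of [chi3(n) n] over pairs of opposite parity: the left
    directly, the right as an Euler series times a Jacobi series after [rot3]. *)
Lemma thetaW_mul : thetaW * theta sgp 24 = 2%:R * eta 2 ^+ 4.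
Proof.
apply: (@smulfI _ 2%:R); first exact: snatr_neq0.
have -> : 2%:R * (2%:R * eta 2 ^+ 4) = (2%:R * eta 2) * (2%:R * eta 2 ^+ 3) by ring.
rewrite -theta_eta // -theta_jacobi //.
apply: fseriesP => N; rewrite scoef_nat !theta_mul //.
have -> : latsum 2 6 N xpredT (fun v => chi12 v.1 * (chi4 v.2 * v.2)) =
   2 * 1 * latsum 8 24 N diff_parity (fun v => chi3 v.1 * v.1).
  rewrite -(@chi12_chi4_sum N (fun v => v.2) _ (fun v => - v.2)) //.
    by apply: latsum_ext => v _; ring.
  by move=> n m; rewrite /rot3 /=; ring.
rewrite mulr1 natz -(sgp_chi3_sum (same_parity_re1 N)).
by congr (_ * _); apply: latsum_ext => v _; ring.
Qed.

(** Even without signs the pairs of equal parity cancel, leaving the sum of [thetaW_mul]. *)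
Lemma thetaW'_mul : thetaW' * theta (fun _ => 1) 24 = 2%:R * eta 2 ^+ 4.
Proof.
rewrite -thetaW_mul; apply: fseriesP => N; rewrite !theta_mul //.
transitivity (latsum 8 24 N diff_parity (fun v => chi3 v.1 * v.1)).
  rewrite (latsum_splitT same_parity) -[RHS]add0r -(same_parity_re1 N).
  by congr (_ + _); apply: latsum_ext => v _; ring.
rewrite -(sgp_chi3_sum (same_parity_re1 N)).
by apply: latsum_ext => v _; ring.
Qed.

Lemma thetaV_mul : thetaV * theta oddz 6 = 4%:R * eta 2 ^+ 4.
Proof.
have -> : 4%:R * eta 2 ^+ 4 = 2%:R * (2%:R * eta 2 ^+ 4) by ring.
rewrite -thetaW_mul; apply: fseriesP => N; rewrite scoef_nat !theta_mul //.
have -> : latsum 8 24 N xpredT (fun v => - (sgp v.1 * chi3 v.1 * v.1) * sgp v.2) =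
   latsum 8 24 N diff_parity (fun v => chi3 v.1 * v.1).
  rewrite -(sgp_chi3_sum (same_parity_re1 N)).
  by apply: latsum_ext => v _; ring.
rewrite odd_pair_supp => [|[x y]]; last first.
  rewrite /odd_pair /oddz /evenz /= => xy.
  by do !case: eqP; rewrite ?mul0r ?mulr0 //; lia.
rewrite odd_pair_sum => [|x y]; last first.
  by congr (_ * _); rewrite /oddz /=; congr (_%:R); lia.
rewrite natz; congr (_ * _).
rewrite -[RHS]addr0 -(@diff_parity_odd0 N (fun v => 3 * v.2)); last by move=> n m /=; ring.
rewrite -latsumD; apply: latsum_ext => -[n m] /rot3_chi[_ [-> ->]].
by rewrite /rot3 /=; ring.
Qed.

Lemma latsum_comb m m' N P (a b c : int) (f g h : int * int -> int) :
  a * latsum m m' N P f + b * latsum m m' N P g + c * latsum m m' N P h =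
  latsum m m' N P (fun v => a * f v + b * g v + c * h v).
Proof. by rewrite !latsumD !latsumZ. Qed.

(** Same argument with fifth powers: the coefficients 1, -10, 5 yield the weight [64 re5] on
    [8 x^2 + 24 y^2], while 5, -10, 1 yield [4 im5] on [2 x^2 + 6 y^2]; up to odd terms [rot3] turns
    [im5] into [-16 re5]. *)
Lemma thetaW_order2 :
  sder (sder thetaW) * theta sgp 24 - 10%:R * sder thetaW * sder (theta sgp 24)
    + 5%:R * thetaW * sder (sder (theta sgp 24)) =
  - 2%:R * (5%:R * sder (sder (eta 2)) * eta 2 ^+ 3
    - 10%:R * sder (eta 2) * sder (eta 2 ^+ 3) + eta 2 * sder (sder (eta 2 ^+ 3))).
Proof.
apply: (@smulfI _ 2%:R); first exact: snatr_neq0.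
transitivity (- (5%:R * sder (sder (2%:R * eta 2)) * (2%:R * eta 2 ^+ 3)
    - 10%:R * sder (2%:R * eta 2) * sder (2%:R * eta 2 ^+ 3)
    + 2%:R * eta 2 * sder (sder (2%:R * eta 2 ^+ 3)))); last first.
  by rewrite !sder_natM; ring.
rewrite -theta_eta // -theta_jacobi // !sder_theta.
rewrite -!mulrA; apply: fseriesP => N.
rewrite scoef_nat !(scoefD, scoefN, scoef_nat) !theta_mul // !natz.
rewrite -[X in X + _ + 5%:Z * _]mul1r -[X in - (_ + X)]mul1r -!mulNr !latsum_comb.
transitivity (2 * (64 * latsum 8 24 N xpredT
    (fun v => - (sgp v.1 * sgp v.2 * chi3 v.1 * re5 v)))).
  congr (_ * _); rewrite -latsumZ; apply: latsum_ext => v _.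
  by rewrite /re5 /=; ring.
transitivity (-4 * latsum 2 6 N xpredT (fun v => chi12 v.1 * chi4 v.2 * im5 v)); last first.
rewrite -[RHS]mulN1r -!latsumZ; apply: latsum_ext => v _.
  by rewrite /im5 /=; ring.
rewrite (sgp_chi3_sum (same_parity_re5 N)).
rewrite (@chi12_chi4_sum N im5 re5 (fun v => im5 (rot3 v) - -16 * re5 v) (-16)).
- ring.
- by move=> x y; rewrite /im5 /=; ring.
- by move=> n m; ring.
- by move=> n m; rewrite /im5 /re5 /rot3 /=; ring.
Qed.

Lemma chi4_even x : evenz x -> chi4 x = 0.
Proof. by rewrite /evenz /chi4; do !case: ifP; lia. Qed.

(** In the coordinates [x + y], [x - y] the weight [x^2 - y^2] is a product and the sign on odd
    pairs becomes [chi4] times [chi4]: this is a square of a Jacobi series. Pairs of even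
    coordinates cancel. *)
Lemma wronskian_one_sgp :
  sder (theta (fun _ => 1) 24) * theta sgp 24 -
  theta (fun _ => 1) 24 * sder (theta sgp 24) = 96%:R * eta 4 ^+ 6.
Proof.
have -> : 96%:R * eta 4 ^+ 6 = 24%:R * ((2%:R * eta 4 ^+ 3) * (2%:R * eta 4 ^+ 3)) by ring.
rewrite -theta_jacobi // !sder_theta; apply: fseriesP => N.
rewrite scoefB scoef_nat !theta_mul // natz -[(3 * 4)%N]/12%N.
pose G (v : int * int) := sgp ((v.1 - v.2) %/ 2)%Z * (v.1 * v.2).
have E1 : latsum 12 12 N same_parity G =
    latsum 24 24 N xpredT (fun v => sgp v.2 * (v.1 * v.1 - v.2 * v.2)).
  apply: (@latsum_reindex _ _ _ _ _ _ _ (fun v => (v.1 + v.2, v.1 - v.2))) => //.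
  - move=> [a b] [c d] _ _ /= [h1 h2]; congr (_, _); lia.
  - move=> [x y] _; rewrite /G /same_parity /evenz /=; split; first lia.
    split; last by ring.
    have -> : ((x + y - (x - y)) %/ 2)%Z = y by lia.
    by ring.
  - move=> [s t]; rewrite /same_parity /evenz /= => st.
    by exists (((s + t) %/ 2)%Z, ((s - t) %/ 2)%Z); rewrite //=; congr (_, _); lia.
have E2 : latsum 12 12 N (fun v => same_parity v && ~~ odd_pair v) G = 0.
  apply: (@latsum_odd0 _ _ _ _ _ (fun v => (- v.1, v.2))) => //.
  - by case=> x y; rewrite /= opprK.
  - by move=> [x y] /=; lia.
  - move=> [x y] /=; rewrite /same_parity /odd_pair /evenz /G /= => xy; split; first lia.
    have -> : sgp ((- x - y) %/ 2)%Z = sgp ((x - y) %/ 2)%Z.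
      by rewrite /sgp; do !case: ifP; lia.
    ring.
have E3 : latsum 12 12 N (fun v => same_parity v && odd_pair v) G =
    latsum 12 12 N xpredT (fun v => chi4 v.1 * v.1 * (chi4 v.2 * v.2)).
  rewrite (latsum_splitT (fun v => same_parity v && odd_pair v)).
  rewrite [X in _ + X]latsum0 ?addr0 => [|[x y] /= xy].
    apply: latsum_ext => -[x y]; rewrite /same_parity /odd_pair /evenz /G /= => xy.
    have -> : sgp ((x - y) %/ 2)%Z = chi4 x * chi4 y.
      by rewrite /sgp /chi4; do !case: ifP; lia.
    ring.
  have [x0|y0] : evenz x \/ evenz y.
    by move: xy; rewrite /same_parity /odd_pair /evenz /=; lia.
    by rewrite (chi4_even x0) !mul0r.
  by rewrite (chi4_even y0) !mul0r mulr0.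
rewrite -E3 -[latsum _ _ _ (fun v => same_parity v && odd_pair v) G]addr0 -E2.
rewrite -latsum_split E1 -mulN1r -!latsumZ -latsumD.
by apply: latsum_ext => v _ /=; ring.
Qed.

(** The same with [x + 2 y], [x - 2 y], whose values are the odd pairs congruent modulo 4. A sign
    change maps these to the other odd pairs, which contribute the same amount. *)
Lemma wronskian_oddz_one :
  sder (theta oddz 6) * theta (fun _ => 1) 24 -
  theta oddz 6 * sder (theta (fun _ => 1) 24) = 12%:R * eta 1 ^+ 6.
Proof.
have -> : 12%:R * eta 1 ^+ 6 = 3%:R * ((2%:R * eta 1 ^+ 3) * (2%:R * eta 1 ^+ 3)) by ring.
rewrite -theta_jacobi // !sder_theta; apply: fseriesP => N.
rewrite scoefB scoef_nat !theta_mul // natz muln1.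
pose Q v := odd_pair v && (((v.1 - v.2) %% 4)%Z == 0).
pose Q' v := odd_pair v && (((v.1 + v.2) %% 4)%Z == 0).
have E1 : latsum 3 3 N Q (fun v => v.1 * v.2) =
    latsum 6 24 N (fun v => ~~ evenz v.1) (fun v => v.1 * v.1 - 4 * (v.2 * v.2)).
  apply: (@latsum_reindex _ _ _ _ _ _ _ (fun v => (v.1 + 2 * v.2, v.1 - 2 * v.2))) => //.
  - by move=> [a b] [c d] _ _ /= [h1 h2]; congr (_, _); lia.
  - move=> [x y]; rewrite /Q /odd_pair /evenz /= => x1; split; first lia.
    by split; ring.
  - move=> [s t]; rewrite /Q /odd_pair /evenz /= => st.
    exists (((s + t) %/ 2)%Z, ((s - t) %/ 4)%Z); last by rewrite /=; congr (_, _); lia.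
    by rewrite /=; lia.
have E2 : latsum 3 3 N Q' (fun v => v.1 * v.2) =
    latsum 3 3 N Q (fun v => -1 * (v.1 * v.2)).
  apply: (@latsum_reindex _ _ _ _ _ _ _ (fun v => (v.1, - v.2))) => //.
  - by move=> [a b] [c d] _ _ /= [-> /oppr_inj ->].
  - move=> [x y]; rewrite /Q /Q' /odd_pair /evenz /= => xy; split; first lia.
    by split; ring.
  - move=> [x y]; rewrite /Q /Q' /odd_pair /evenz /= => xy.
    exists (x, - y); last by rewrite /= opprK.
    by rewrite /=; lia.
have -> : latsum 3 3 N xpredT (fun v => chi4 v.1 * v.1 * (chi4 v.2 * v.2)) =
    2 * latsum 3 3 N Q (fun v => v.1 * v.2).
  rewrite (latsum_splitT Q) (latsum_split 3 3 N Q' (fun v => ~~ Q v)).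
  rewrite [X in _ + (_ + X)]latsum0 ?addr0 => [|[x y] /= xy]; last first.
    have [x0|y0] : evenz x \/ evenz y.
      by move: xy; rewrite /Q /Q' /odd_pair /evenz /=; lia.
      by rewrite (chi4_even x0) !mul0r.
    by rewrite (chi4_even y0) !mul0r mulr0.
  have -> : latsum 3 3 N Q (fun v => chi4 v.1 * v.1 * (chi4 v.2 * v.2)) =
            latsum 3 3 N Q (fun v => v.1 * v.2).
    apply: latsum_ext => -[x y]; rewrite /Q /odd_pair /evenz /= => xy.
    have E : chi4 x * chi4 y = 1 by rewrite /chi4; do !case: ifP; lia.
    by rewrite mulrACA E mul1r.
  have -> : latsum 3 3 N (fun v => ~~ Q v && Q' v) (fun v => chi4 v.1 * v.1 * (chi4 v.2 * v.2)) =
            -1 * latsum 3 3 N Q' (fun v => v.1 * v.2).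
    rewrite -latsumZ /latsum; apply: eq_big => [[x y]|[x y] /andP[]].
      by congr (_ && _); rewrite /Q /Q' /odd_pair /evenz /=; lia.
    rewrite /Q /Q' /odd_pair /evenz /= => xy _.
    have E : chi4 x * chi4 y = -1 by rewrite /chi4; do !case: ifP; lia.
    by rewrite mulrACA E.
  by rewrite E2 latsumZ; ring.
rewrite E1 -[X in _ - X]mul1r -mulNr -!latsumZ -latsumD.
rewrite (latsum_splitT (fun v => ~~ evenz v.1)) [X in _ + X]latsum0 ?addr0.
  apply: latsum_ext => -[x y]; rewrite /evenz /oddz /= => x1.
  have -> : (x %% 2)%Z == 1 by lia.
  by rewrite /=; ring.
move=> [x y]; rewrite /evenz /oddz /= => /negPn/eqP ->.
by rewrite /=; ring.
Qed.

(** * Differential relations *)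

Section IteratedDerivatives.
Variable R : idomainType.
Implicit Types f g p u : fseries R.

Lemma sderD f g : sder (f + g) = sder f + sder g. Proof. exact: raddfD. Qed.
Lemma sderN f : sder (- f) = - sder f. Proof. exact: raddfN. Qed.

Lemma sder_mul_logder p f u : sder f = u * f -> sder (p * f) = (sder p + p * u) * f.
Proof. by move=> Df; rewrite sderM Df; ring. Qed.

(* The bracket attached to the real part of (x + i y)^12: for theta series f, g
   with exponents m x^2 and m' y^2, D acts as x^2 on f and as y^2 on g, suitably
   scaled. *)
Definition rc12 f g :=
  iter 6 (@sder R) f * g - 66%:R * iter 5 (@sder R) f * sder g
  + 495%:R * iter 4 (@sder R) f * iter 2 (@sder R) g
  - 924%:R * iter 3 (@sder R) f * iter 3 (@sder R) g
  + 495%:R * iter 2 (@sder R) f * iter 4 (@sder R) g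
  - 66%:R * sder f * iter 5 (@sder R) g + f * iter 6 (@sder R) g.

Ltac derive := rewrite !(sderD, sderN, sder_natM, sderM, sderX).

(* For f = eta_k, T, q and r are proportional to the Eisenstein series E_2, E_4
   and E_6 of k tau. *)
Section LevelOne.
Variables f T q r : fseries R.
Hypotheses (Df : sder f = T * f) (DT : sder T = 2%:R * (T ^+ 2 - q))
  (Dq : sder q = 8%:R * (T * q - r)) (Dr : sder r = 12%:R * (T * r - q ^+ 2)).

Lemma iter2_sder : iter 2 (@sder R) f = (3%:R * T ^+ 2 - 2%:R * q) * f.
Proof. rewrite /= Df (sder_mul_logder _ Df) DT; ring. Qed.

Lemma iter3_sder : iter 3 (@sder R) f =
  (15%:R * T ^+ 3 - 30%:R * T * q + 16%:R * r) * f.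
Proof.
rewrite iterS iter2_sder (sder_mul_logder _ Df); congr (_ * _).
derive; rewrite DT Dq; ring.
Qed.

Lemma iter4_sder : iter 4 (@sder R) f =
  (105%:R * T ^+ 4 - 420%:R * T ^+ 2 * q + 448%:R * T * r - 132%:R * q ^+ 2) * f.
Proof.
rewrite iterS iter3_sder (sder_mul_logder _ Df); congr (_ * _).
derive; rewrite DT Dq Dr; ring.
Qed.

Lemma iter5_sder : iter 5 (@sder R) f =
  (945%:R * T ^+ 5 - 6300%:R * T ^+ 3 * q + 10080%:R * T ^+ 2 * r
   - 5940%:R * T * q ^+ 2 + 1216%:R * q * r) * f.
Proof.
rewrite iterS iter4_sder (sder_mul_logder _ Df); congr (_ * _).
derive; rewrite DT Dq Dr; ring.
Qed.

Lemma iter6_sder : iter 6 (@sder R) f =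
  (10395%:R * T ^+ 6 - 103950%:R * T ^+ 4 * q + 221760%:R * T ^+ 3 * r
   - 196020%:R * T ^+ 2 * q ^+ 2 + 80256%:R * T * q * r - 2712%:R * q ^+ 3
   - 9728%:R * r ^+ 2) * f.
Proof.
rewrite iterS iter5_sder (sder_mul_logder _ Df); congr (_ * _).
derive; rewrite DT Dq Dr; ring.
Qed.
End LevelOne.

(* For f = theta_4, A = y + 2 z and s = z (y + z). *)
Section LevelTwo.
Variables f T A s : fseries R.
Hypotheses (Df : sder f = T * f) (DT : sder T = 2%:R * (T ^+ 2 - 36%:R * s))
  (DA : sder A = 4%:R * (T * A + 12%:R * s))
  (Ds : sder s = 8%:R * (T * s + 3%:R * A * s)).

Lemma iter2_sder' : iter 2 (@sder R) f = (3%:R * T ^+ 2 - 72%:R * s) * f.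
Proof. rewrite /= Df (sder_mul_logder _ Df) DT; ring. Qed.

Lemma iter3_sder' : iter 3 (@sder R) f =
  (15%:R * T ^+ 3 - 1080%:R * T * s - 1728%:R * A * s) * f.
Proof.
rewrite iterS iter2_sder' (sder_mul_logder _ Df); congr (_ * _).
derive; rewrite DT Ds; ring.
Qed.

Lemma iter4_sder' : iter 4 (@sder R) f =
  (105%:R * T ^+ 4 - 15120%:R * T ^+ 2 * s - 48384%:R * T * A * s
   - 41472%:R * A ^+ 2 * s - 5184%:R * s ^+ 2) * f.
Proof.
rewrite iterS iter3_sder' (sder_mul_logder _ Df); congr (_ * _).
derive; rewrite DT DA Ds; ring.
Qed.

Lemma iter5_sder' : iter 5 (@sder R) f =
  (945%:R * T ^+ 5 - 226800%:R * T ^+ 3 * s - 1088640%:R * T ^+ 2 * A * s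
   - 1866240%:R * T * A ^+ 2 * s - 233280%:R * T * s ^+ 2
   - 995328%:R * A ^+ 3 * s - 746496%:R * A * s ^+ 2) * f.
Proof.
rewrite iterS iter4_sder' (sder_mul_logder _ Df); congr (_ * _).
derive; rewrite DT DA Ds; ring.
Qed.

Lemma iter6_sder' : iter 6 (@sder R) f =
  (10395%:R * T ^+ 6 - 3742200%:R * T ^+ 4 * s - 23950080%:R * T ^+ 3 * A * s
   - 61585920%:R * T ^+ 2 * A ^+ 2 * s - 7698240%:R * T ^+ 2 * s ^+ 2
   - 65691648%:R * T * A ^+ 3 * s - 49268736%:R * T * A * s ^+ 2
   - 23887872%:R * A ^+ 4 * s - 44789760%:R * A ^+ 2 * s ^+ 2
   - 19035648%:R * s ^+ 3) * f.
Proof.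
rewrite iterS iter5_sder' (sder_mul_logder _ Df); congr (_ * _).
derive; rewrite DT DA Ds; ring.
Qed.
End LevelTwo.

(** The bracket is modular, so the quasimodular [T] cancels and only [q] and [r] remain. *)
Lemma rc12_self (f T q r : fseries R) :
    sder f = T * f -> sder T = 2%:R * (T ^+ 2 - q) ->
    sder q = 8%:R * (T * q - r) -> sder r = 12%:R * (T * r - q ^+ 2) ->
  rc12 f f = (255936%:R * q ^+ 3 - 256000%:R * r ^+ 2) * f ^+ 2.
Proof.
move=> Df DT Dq Dr; rewrite /rc12.
rewrite (iter6_sder Df DT Dq Dr) (iter5_sder Df DT Dq Dr).
rewrite (iter4_sder Df DT Dq Dr) (iter3_sder Df DT Dq) (iter2_sder Df DT) Df.
ring.
Qed.

(** The first bracket contains [-64 A^6] and the second [64 A^6]; these cancel, and what remains is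
    a multiple of the cusp form [(A^2 - 4 s)^2 s]. *)
Lemma rc12_sum (e1 e2 t4 U A s : fseries R) :
    sder e1 = U * e1 -> sder e2 = (U + A) * e2 -> sder t4 = (U - A) * t4 ->
    t4 * e2 = e1 ^+ 2 ->
    sder U = 2%:R * (U ^+ 2 - (A ^+ 2 + 12%:R * s)) ->
    sder A = 4%:R * (U * A - A ^+ 2 + 12%:R * s) ->
    sder s = 8%:R * (U * s + 2%:R * A * s) ->
  rc12 e1 e1 + rc12 e2 t4 =
  65235456%:R * ((A ^+ 2 - 4%:R * s) ^+ 2 * s) * e1 ^+ 2.
Proof.
move=> De1 De2 Dt4 t4e2 DU DA Ds.
(* These play the role of E_4 and E_6 at tau; [q2] and [r2] below are 4 E_4 and 8 E_6 at 2 tau. *)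
pose q1 := A ^+ 2 + 12%:R * s; pose r1 := A ^+ 3 - 36%:R * A * s.
have DU1 : sder U = 2%:R * (U ^+ 2 - q1) by [].
have Dq1 : sder q1 = 8%:R * (U * q1 - r1).
  by rewrite /q1 /r1; derive; rewrite DA Ds; ring.
have Dr1 : sder r1 = 12%:R * (U * r1 - q1 ^+ 2).
  by rewrite /q1 /r1; derive; rewrite DA Ds; ring.
pose q2 := 4%:R * A ^+ 2 - 12%:R * s; pose r2 := 8%:R * A ^+ 3 - 36%:R * A * s.
have DV2 : sder (U + A) = 2%:R * ((U + A) ^+ 2 - q2).
  by rewrite /q2; derive; rewrite DU DA; ring.
have Dq2 : sder q2 = 8%:R * ((U + A) * q2 - r2).
  by rewrite /q2 /r2; derive; rewrite DA Ds; ring.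
have Dr2 : sder r2 = 12%:R * ((U + A) * r2 - q2 ^+ 2).
  by rewrite /q2 /r2; derive; rewrite DA Ds; ring.
have DT : sder (U - A) = 2%:R * ((U - A) ^+ 2 - 36%:R * s).
  by derive; rewrite DU DA; ring.
have DA' : sder A = 4%:R * ((U - A) * A + 12%:R * s) by rewrite DA; ring.
have Ds' : sder s = 8%:R * ((U - A) * s + 3%:R * A * s) by rewrite Ds; ring.
rewrite (rc12_self De1 DU1 Dq1 Dr1).
suff -> : rc12 e2 t4 = (64%:R * A ^+ 6 + 37589760%:R * A ^+ 4 * s
    - 300672000%:R * A ^+ 2 * s ^+ 2 + 601509888%:R * s ^+ 3) * e1 ^+ 2.
  by rewrite /q1 /r1; ring.
rewrite /rc12 -t4e2.
rewrite (iter6_sder De2 DV2 Dq2 Dr2) (iter5_sder De2 DV2 Dq2 Dr2).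
rewrite (iter4_sder De2 DV2 Dq2 Dr2) (iter3_sder De2 DV2 Dq2) (iter2_sder De2 DV2).
rewrite (iter6_sder' Dt4 DT DA' Ds') (iter5_sder' Dt4 DT DA' Ds').
rewrite (iter4_sder' Dt4 DT DA' Ds') (iter3_sder' Dt4 DT Ds') (iter2_sder' Dt4 DT).
rewrite De2 Dt4 /q2 /r2; ring.
Qed.
End IteratedDerivatives.

Section LeadingTerm.
Variable R : comNzRingType.
Implicit Types f g : fseries R.

Lemma scoefM_lead f g a b :
    (forall n, (n < a)%N -> f n = 0) -> (forall n, (n < b)%N -> g n = 0) ->
  (f * g) (a + b)%N = f a * g b /\ forall n, (n < a + b)%N -> (f * g) n = 0.
Proof.
move=> f0 g0; split=> [|n lt_n]; rewrite scoefM.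
  have lt_a : (a < (a + b).+1)%N by lia.
  rewrite (bigD1 (Ordinal lt_a)) //= addKn big1 ?addr0 // => i.
  rewrite -val_eqE /= => neq_ia; have := ltn_ord i => lt_i.
  case: (ltngtP i a) neq_ia => // [/f0 ->|lt_ai] _; first by rewrite mul0r.
  by rewrite g0 ?mulr0 //; lia.
apply: big1 => i _; have := ltn_ord i => lt_i.
have [/f0 ->|le_ai] := ltnP i a; first by rewrite mul0r.
by rewrite g0 ?mulr0 //; lia.
Qed.

Lemma scoefX_lead f a k : (forall n, (n < a)%N -> f n = 0) ->
  (f ^+ k) (k * a)%N = f a ^+ k /\ forall n, (n < k * a)%N -> (f ^+ k) n = 0.
Proof.
move=> f0; elim: k => [|k [IH1 IH2]]; first by rewrite !expr0 mul0n.
by rewrite mulSn !exprS -IH1; apply: scoefM_lead.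
Qed.
End LeadingTerm.

Section LogDerivative.
Variable R : idomainType.
Implicit Types f g h a b c : fseries R.

Lemma logderM f g a b : sder f = a * f -> sder g = b * g ->
  sder (f * g) = (a + b) * (f * g).
Proof. by move=> Df Dg; rewrite sderM Df Dg; ring. Qed.

Lemma logderX f a n : sder f = a * f -> sder (f ^+ n) = n%:R * a * f ^+ n.
Proof.
move=> Df; case: n => [|n]; first by rewrite expr0 sder1 !mul0r.
by rewrite sderX Df exprS; ring.
Qed.

Lemma logderZ k f a : sder f = a * f -> sder (k%:R * f) = a * (k%:R * f).
Proof. by move=> Df; rewrite sder_natM Df mulrCA. Qed.

Lemma logder2 f a : sder f = a * f -> sder (sder f) = (sder a + a ^+ 2) * f.
Proof. by move=> Df; rewrite Df sderM Df; ring. Qed.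

Lemma logder_div f g h b c : g != 0 -> f * g = h ->
  sder g = b * g -> sder h = c * h -> sder f = (c - b) * f.
Proof.
move=> g0 <- Dg; rewrite sderM Dg => E.
apply: (smulfI g0); rewrite mulrC mulrA.
have -> : sder f * g = c * (f * g) - f * (b * g) by rewrite -E addrK.
by ring.
Qed.
End LogDerivative.

Lemma pinf_coef0 e : (0 < e)%N -> pinf e 0%N = 1.
Proof. by move=> e0; rewrite pinf.unlock [LHS]/= qfact_coef0 // sXn_coef0. Qed.

Lemma eta_lead k : (0 < k)%N -> eta k k = 1.
Proof.
move=> k0; rewrite eta.unlock scoefXnM ltnn subnn pinf_coef0 //; lia.
Qed.

Lemma eta_neq0 k : (0 < k)%N -> eta k != 0.
Proof.
by move=> k0; apply/eqP => /(congr1 (fun f : fseries int => f k)); rewrite eta_lead.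
Qed.

(** The factor [t^k] contributes [k]; the product has constant term 1, so it can be inverted. *)
Lemma eta_logder k : (0 < k)%N ->
  exists2 U : fseries int, sder (eta k) = U * eta k & U 0%N = k%:R.
Proof.
move=> k0; have p1 : pinf (24 * k) 0%N = 1 by apply: pinf_coef0; lia.
have [g pg] := series_inverse p1.
have DX : sder (sX int ^+ k) = k%:R * sX int ^+ k.
  apply: fseriesP => n; rewrite sderE scoef_nat sXnE /=.
  by case: eqP => [->|]; rewrite ?mulr0.
exists ((k%:R * pinf (24 * k) + sder (pinf (24 * k))) * g).
  rewrite eta.unlock sderM DX; move: pg; move: (pinf _) => p pg.
  transitivity ((k%:R * p + sder p) * sX int ^+ k * (p * g)); last by ring.
  by rewrite pg; ring.
have g1 : g 0%N = 1 by have := scoefM0 (pinf (24 * k)) g; rewrite pg p1 mul1r scoef1.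
by rewrite scoefM0 g1 mulr1 scoefD scoef_nat p1 sderE mul0r addr0 mulr1.
Qed.

(* e_k stands for eta_k, W for thetaW, and t_2, t_3, t_4 for the theta constants
   theta oddz 6, theta (fun _ => 1) 24 and theta sgp 24. *)
Section Ramanujan.
Variables (e1 e2 e4 t2 t3 t4 W U V X : fseries int).
Hypotheses (e1_neq0 : e1 != 0) (e2_neq0 : e2 != 0) (e4_neq0 : e4 != 0).
Hypotheses (De1 : sder e1 = U * e1) (De2 : sder e2 = V * e2) (De4 : sder e4 = X * e4).
Hypotheses (t4E : t4 * e2 = e1 ^+ 2) (t3E : t3 * (e1 ^+ 2 * e4 ^+ 2) = e2 ^+ 5)
  (t2E : t2 * e2 = 2%:R * e4 ^+ 2) (WE : W * t4 = 2%:R * e2 ^+ 4).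
Hypothesis W34 : sder t3 * t4 - t3 * sder t4 = 96%:R * e4 ^+ 6.
Hypothesis W23 : sder t2 * t3 - t2 * sder t3 = 12%:R * e1 ^+ 6.
Hypothesis W2 : sder (sder W) * t4 - 10%:R * sder W * sder t4 + 5%:R * W * sder (sder t4) =
  - 2%:R * (5%:R * sder (sder e2) * e2 ^+ 3
    - 10%:R * sder e2 * sder (e2 ^+ 3) + e2 * sder (sder (e2 ^+ 3))).
Let y := t4 ^+ 4.
Let z := t2 ^+ 4.

Lemma logder_t4 : sder t4 = (2%:R * U - V) * t4.
Proof. exact: logder_div e2_neq0 t4E De2 (logderX 2 De1). Qed.

Lemma logder_t2 : sder t2 = (2%:R * X - V) * t2.
Proof. exact: logder_div e2_neq0 t2E De2 (logderZ 2 (logderX 2 De4)). Qed.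

Lemma logder_t3 : sder t3 = (5%:R * V - (2%:R * U + 2%:R * X)) * t3.
Proof.
apply: logder_div t3E (logderM (logderX 2 De1) (logderX 2 De4)) (logderX 5 De2).
by rewrite smulf_neq0 ?sexpf_neq0.
Qed.

Lemma t4_neq0 : t4 != 0.
Proof.
apply: contraTneq e1_neq0 => t40; move: t4E; rewrite t40 mul0r => /esym/eqP.
by apply: contraTN => /(sexpf_neq0 2).
Qed.

Lemma y_e2 : y * e2 ^+ 4 = e1 ^+ 8.
Proof. by rewrite /y -exprMn t4E -exprM. Qed.

Lemma z_e2 : z * e2 ^+ 4 = 16%:R * e4 ^+ 8.
Proof. by rewrite /z -exprMn t2E exprMn -exprM -natrX. Qed.

(** A Wronskian divided by the product of its two series is the difference of their logarithmic
    derivatives; the eta quotients then turn [W34] into a multiple of [z]. Likewise [W23] gives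
    [logder_y]. *)
Lemma logder_z : 3%:R * V - 2%:R * U - X = 3%:R * z.
Proof.
have t34 : t3 * t4 * e4 ^+ 2 = e2 ^+ 4.
  apply: (smulfI e2_neq0); rewrite -exprS -t3E -t4E; ring.
apply: (smulfI (smulf_neq0 (snatr_neq0 _ 1) (sexpf_neq0 4 e2_neq0))).
have -> : 2%:R * e2 ^+ 4 * (3%:R * z) = 6%:R * (z * e2 ^+ 4) by ring.
rewrite z_e2; have -> : 6%:R * (16%:R * e4 ^+ 8) = 96%:R * e4 ^+ 6 * e4 ^+ 2 by ring.
rewrite -W34 logder_t3 logder_t4 -t34; ring.
Qed.

Lemma t2_t3 : t2 * t3 * e1 ^+ 2 = 2%:R * e2 ^+ 4.
Proof.
apply: (smulfI e2_neq0); apply: (smulfI (sexpf_neq0 2 e4_neq0)).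
transitivity ((t2 * e2) * (t3 * (e1 ^+ 2 * e4 ^+ 2))); first by ring.
by rewrite t2E t3E; ring.
Qed.

Lemma logder_y : 2%:R * X + U - 3%:R * V = 3%:R * y.
Proof.
apply: (smulfI (smulf_neq0 (snatr_neq0 _ 3) (sexpf_neq0 4 e2_neq0))).
have -> : 4%:R * e2 ^+ 4 * (3%:R * y) = 12%:R * (y * e2 ^+ 4) by ring.
rewrite y_e2; have -> : 12%:R * e1 ^+ 8 = 12%:R * e1 ^+ 6 * e1 ^+ 2 by ring.
rewrite -W23 logder_t3 logder_t2.
transitivity (2%:R * (2%:R * X + U - 3%:R * V) * (2%:R * e2 ^+ 4)); first by ring.
by rewrite -t2_t3; ring.
Qed.

(** The two Wronskian relations are linear in [U], [V], [X]; solving them leaves [U], [y], [z] as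
    generators. *)
Lemma logder_e4 : X = U + 3%:R * (y + z).
Proof. by rewrite mulrDr -logder_y -logder_z; ring. Qed.

Lemma logder_e2 : V = U + y + 2%:R * z.
Proof.
apply: (smulfI (snatr_neq0 _ 2)); apply: (addIr (- 2%:R * U - X)).
transitivity (3%:R * z); first by rewrite -logder_z; ring.
by rewrite logder_e4; ring.
Qed.

Lemma sder_y : sder y = 4%:R * y * (U - y - 2%:R * z).
Proof. by rewrite /y (logderX 4 logder_t4) -/y logder_e2; ring. Qed.

Lemma sder_z : sder z = 4%:R * z * (U + 5%:R * y + 4%:R * z).
Proof. by rewrite /z (logderX 4 logder_t2) -/z logder_e2 logder_e4; ring. Qed.

Lemma logder_W : sder W = (5%:R * V - 2%:R * U) * W.
Proof.
rewrite (logder_div t4_neq0 WE logder_t4 (logderZ 2 (logderX 4 De2))); ring.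
Qed.

(** Ramanujan's equation for E_2, with [y^2 + 16 y z + 16 z^2] as E_4. After division by [2 e2^4],
    [W2] is linear in [D U] with coefficient 16, and all other terms are known. *)
Lemma sder_U : sder U = 2%:R * (U ^+ 2 - (y ^+ 2 + 16%:R * y * z + 16%:R * z ^+ 2)).
Proof.
have := W2; rewrite (logder2 logder_W) (logder2 logder_t4) (logder2 De2).
rewrite (logder2 (logderX 3 De2)) logder_W logder_t4 De2 (logderX 3 De2).
have DV : sder V = sder U + sder y + 2%:R * sder z.
  by rewrite {1}logder_e2 !raddfD /= sder_natM.
set w := 5%:R * V - 2%:R * U; set f := 2%:R * U - V.
have Dw : sder w = 5%:R * sder V - 2%:R * sder U by rewrite raddfB /= !sder_natM.
have Df : sder f = 2%:R * sder U - sder V by rewrite raddfB /= sder_natM.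
have D3 : sder (3%:R * V) = 3%:R * sder V by rewrite sder_natM.
rewrite D3 Dw Df => E.
have {}E : 2%:R * e2 ^+ 4 * (16%:R * sder U) =
  2%:R * e2 ^+ 4 * (10%:R * w * f - w ^+ 2 - 5%:R * f ^+ 2 + 16%:R * V ^+ 2
                    - 8%:R * (sder y + 2%:R * sder z)).
  apply/eqP; rewrite -subr_eq0; move/eqP: E; rewrite -subr_eq0 DV => /eqP <-.
  apply/eqP.
  transitivity ((W * t4) * (5%:R * (sder U + sder y + 2%:R * sder z) - 2%:R * sder U + w ^+ 2
     - 10%:R * w * f + 5%:R * (2%:R * sder U - (sder U + sder y + 2%:R * sder z) + f ^+ 2))
     + 2%:R * e2 ^+ 4 * (8%:R * (sder U + sder y + 2%:R * sder z) - 16%:R * V ^+ 2)).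
    by rewrite WE; ring.
  ring.
move/(smulfI (smulf_neq0 (snatr_neq0 _ 1) (sexpf_neq0 4 e2_neq0))) in E.
apply: (smulfI (snatr_neq0 _ 15)); rewrite E /w /f sder_y sder_z logder_e2; ring.
Qed.

(** First Rankin-Cohen bracket in weights 3/2 and 1/2, whence the coefficients 1 and -3. *)
Lemma order8 :
  sder W * t4 - 3%:R * W * sder t4 = 16%:R * (e1 ^+ 8 + 32%:R * e4 ^+ 8).
Proof.
rewrite logder_W logder_t4 logder_e2.
transitivity (8%:R * (y + 2%:R * z) * (W * t4)); first by ring.
rewrite WE -y_e2; have -> : 32%:R * e4 ^+ 8 = 2%:R * (z * e2 ^+ 4) by rewrite z_e2; ring.
by ring.
Qed.

(** Second Rankin-Cohen bracket of two series of weight 3/2, whence 3, -10, 3; it collapses to a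
    multiple of [y^2 W e2^3]. *)
Lemma order14 :
  3%:R * sder (sder W) * e2 ^+ 3 - 10%:R * sder W * sder (e2 ^+ 3)
    + 3%:R * W * sder (sder (e2 ^+ 3)) = - 360%:R * e1 ^+ 14.
Proof.
rewrite (logder2 logder_W) (logder2 (logderX 3 De2)) logder_W (logderX 3 De2).
have DV : sder V = sder U + sder y + 2%:R * sder z.
  by rewrite {1}logder_e2 !sderD sder_natM.
have -> : sder (5%:R * V - 2%:R * U) = 5%:R * sder V - 2%:R * sder U.
  by rewrite sderD sderN !sder_natM.
rewrite sder_natM DV sder_U sder_y sder_z logder_e2.
transitivity (- 180%:R * (y ^+ 2 * W * e2 ^+ 3)); first by ring.
apply: (smulfI e2_neq0); apply: (smulfI t4_neq0).
transitivity (- 180%:R * (y * e2 ^+ 4) * y * (W * t4)); first by ring.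
rewrite WE y_e2.
have -> : - 180%:R * e1 ^+ 8 * y * (2%:R * e2 ^+ 4) = - 360%:R * e1 ^+ 8 * (y * e2 ^+ 4) by ring.
rewrite y_e2; transitivity (- 360%:R * e1 ^+ 14 * (t4 * e2)); last by ring.
by rewrite t4E; ring.
Qed.

(** In equal weights 3/2 the first bracket is the Wronskian; the difference of logarithmic
    derivatives is a multiple of [y]. *)
Lemma order10 (W' V' : fseries int) :
    W' * t3 = 2%:R * e2 ^+ 4 -> V' * t2 = 4%:R * e2 ^+ 4 ->
  V' * sder W' - sder V' * W' = 24%:R * e1 ^+ 10.
Proof.
move=> W'E V'E.
have e24 := logderX 4 De2.
have t3_neq0 : t3 != 0.
  apply: contraTneq e2_neq0 => t30; move: t3E; rewrite t30 mul0r => /esym/eqP.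
  by apply: contraTN => /(sexpf_neq0 5).
have t2_neq0 : t2 != 0.
  apply: contraTneq e4_neq0 => t20; move: t2E; rewrite t20 mul0r => /esym/eqP.
  by apply: contraTN => /(sexpf_neq0 2) /(smulf_neq0 (snatr_neq0 _ 1)).
rewrite (logder_div t3_neq0 W'E logder_t3 (logderZ 2 e24)).
rewrite (logder_div t2_neq0 V'E logder_t2 (logderZ 4 e24)).
have t23 : t2 * t3 * e1 ^+ 2 = 2%:R * e2 ^+ 4 := t2_t3.
apply: (smulfI (smulf_neq0 (snatr_neq0 _ 1) (sexpf_neq0 4 e2_neq0))).
rewrite -t23.
transitivity ((W' * t3) * (V' * t2) * (2%:R * U + 4%:R * X - 6%:R * V) * e1 ^+ 2).
  by ring.
rewrite W'E V'E logder_e4 logder_e2.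
transitivity (48%:R * (y * e2 ^+ 4) * e2 ^+ 4 * e1 ^+ 2); first by ring.
rewrite y_e2; transitivity (24%:R * (2%:R * e2 ^+ 4) * e1 ^+ 10); first by ring.
by rewrite -t23; ring.
Qed.

(** Both sides satisfy [D f = 24 U f], and [24 U] has constant term 24, so only the coefficient of
    [t^24] is compared. *)
Lemma discriminant : (y ^+ 4 * z * (y + z)) 24%N = 16 -> U 0%N = 1 -> e1 1%N = 1 ->
    (forall n, (n < 1)%N -> e1 n = 0) ->
  y ^+ 4 * z * (y + z) = 16%:R * e1 ^+ 24.
Proof.
move=> yz24 U0 e11 e10.
apply: (@log_derivative_inj _ (24%:R * U) _ _ 24).
- have ly : sder y = 4%:R * (U - y - 2%:R * z) * y by rewrite sder_y mulrAC.
  have lz : sder z = 4%:R * (U + 5%:R * y + 4%:R * z) * z by rewrite sder_z mulrAC.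
  have lyz : sder (y + z) = (4%:R * U - 4%:R * y + 16%:R * z) * (y + z).
    by rewrite sderD sder_y sder_z; ring.
  rewrite (logderM (logderM (logderX 4 ly) lz) lyz); ring.
- by rewrite sder_natM (logderX 24 De1); ring.
- by rewrite scoef_nat U0 mulr1.
- rewrite yz24 scoef_nat.
  by have [-> _] := scoefX_lead 24 e10; rewrite e11 expr1n.
Qed.

(** The constant is [16 * 65235456], kept factored because its primes must be invertible modulo [l]
    later. *)
Lemma order26 : y ^+ 4 * z * (y + z) = 16%:R * e1 ^+ 24 ->
  rc12 e1 e1 + rc12 e2 t4 =
    2%:R ^+ 13 * (3%:R ^+ 4 * (11%:R ^+ 2 * (13%:R * e1 ^+ 26))).
Proof.
move=> yz.
pose A := y + 2%:R * z; pose s := z * (y + z).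
have De2' : sder e2 = (U + A) * e2 by rewrite De2 logder_e2 addrA.
have Dt4 : sder t4 = (U - A) * t4 by rewrite logder_t4 logder_e2 /A; ring.
have DU : sder U = 2%:R * (U ^+ 2 - (A ^+ 2 + 12%:R * s)).
  by rewrite sder_U /A /s; ring.
have DA : sder A = 4%:R * (U * A - A ^+ 2 + 12%:R * s).
  by rewrite /A /s sderD sder_natM sder_y sder_z; ring.
have Ds : sder s = 8%:R * (U * s + 2%:R * A * s).
  by rewrite /A /s sderM sderD sder_y sder_z; ring.
rewrite (rc12_sum De1 De2' Dt4 t4E DU DA Ds).
(* In terms of [y] and [z], [A^2 - 4 s] is [y^2]. *)
have -> : (A ^+ 2 - 4%:R * s) ^+ 2 * s = y ^+ 4 * z * (y + z) by rewrite /A /s; ring.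
by rewrite yz; ring.
Qed.
End Ramanujan.

Section EtaTheta.

Lemma eta_low k n : (n < k)%N -> eta k n = 0.
Proof. by move=> lt_nk; rewrite eta.unlock scoefXnM lt_nk. Qed.

Lemma theta_sgp0 : theta sgp 24 0%N = 1.
Proof. by rewrite /= big_cons big_nil. Qed.

Lemma theta_oddz_lead :
  theta oddz 6 6%N = 2 /\ forall n, (n < 6)%N -> theta oddz 6 n = 0.
Proof.
split; first by rewrite [LHS]/= /box [iota _ _]/= !big_cons big_nil.
move=> n lt_n6; apply: big1 => x /eqP xn; rewrite /oddz.
case: eqP => // x1; have : x * x >= 1 by nia.
by have := sqr_absz x; lia.
Qed.

Lemma discriminant_lead (y := theta sgp 24 ^+ 4) (z := theta oddz 6 ^+ 4) :
  (y ^+ 4 * z * (y + z)) 24%N = 16.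
Proof.
have low0 (f : fseries int) n : (n < 0)%N -> f n = 0 by [].
have [z24 z0] := scoefX_lead 4 theta_oddz_lead.2.
have [y0 _] := scoefX_lead 4 (low0 (theta sgp 24)).
have [yy _] := scoefX_lead 4 (low0 y).
have [yz yz0] := scoefM_lead (low0 (y ^+ 4)) z0.
have [-> _] := scoefM_lead yz0 (low0 (y + z)).
have z00 : z 0%N = 0 by apply: z0.
rewrite yz scoefD z00 addr0 z24 theta_oddz_lead.1.
have Y : y 0%N = 1 by move: y0; rewrite theta_sgp0 expr1n.
by rewrite Y; move: yy; rewrite Y expr1n => ->.
Qed.

Let n1 := eta_neq0 (isT : (0 < 1)%N).
Let n2 := eta_neq0 (isT : (0 < 2)%N).
Let n4 := eta_neq0 (isT : (0 < 4)%N).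

Lemma eta_order8 : sder thetaW * theta sgp 24 - 3%:R * thetaW * sder (theta sgp 24) =
  16%:R * (eta 1 ^+ 8 + 32%:R * eta 4 ^+ 8).
Proof.
have [U DU _] := eta_logder (isT : (0 < 1)%N).
have [V DV _] := eta_logder (isT : (0 < 2)%N).
have [X DX _] := eta_logder (isT : (0 < 4)%N).
exact: (order8 n1 n2 n4 DU DV DX theta_sgp theta_one theta_oddz thetaW_mul
  wronskian_one_sgp wronskian_oddz_one).
Qed.

Lemma eta_order10 : thetaV * sder thetaW' - sder thetaV * thetaW' = 24%:R * eta 1 ^+ 10.
Proof.
have [U DU _] := eta_logder (isT : (0 < 1)%N).
have [V DV _] := eta_logder (isT : (0 < 2)%N).
have [X DX _] := eta_logder (isT : (0 < 4)%N).
exact: (order10 n1 n2 n4 DU DV DX theta_sgp theta_one theta_oddz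
  wronskian_one_sgp wronskian_oddz_one thetaW'_mul thetaV_mul).
Qed.

Lemma eta_order14 :
  3%:R * sder (sder thetaW) * eta 2 ^+ 3 - 10%:R * sder thetaW * sder (eta 2 ^+ 3)
    + 3%:R * thetaW * sder (sder (eta 2 ^+ 3)) = - 360%:R * eta 1 ^+ 14.
Proof.
have [U DU _] := eta_logder (isT : (0 < 1)%N).
have [V DV _] := eta_logder (isT : (0 < 2)%N).
have [X DX _] := eta_logder (isT : (0 < 4)%N).
exact: (order14 n1 n2 n4 DU DV DX theta_sgp theta_one theta_oddz thetaW_mul
  wronskian_one_sgp wronskian_oddz_one thetaW_order2).
Qed.

Lemma eta_order26 :
  rc12 (eta 1) (eta 1) + rc12 (eta 2) (theta sgp 24) =
    2%:R ^+ 13 * (3%:R ^+ 4 * (11%:R ^+ 2 * (13%:R * eta 1 ^+ 26))).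
Proof.
have [U DU U0] := eta_logder (isT : (0 < 1)%N).
have [V DV _] := eta_logder (isT : (0 < 2)%N).
have [X DX _] := eta_logder (isT : (0 < 4)%N).
apply: (order26 n1 n2 n4 DU DV DX theta_sgp theta_one theta_oddz thetaW_mul
  wronskian_one_sgp wronskian_oddz_one thetaW_order2).
apply: (discriminant n1 n2 n4 DU DV DX theta_sgp theta_one theta_oddz
  wronskian_one_sgp wronskian_oddz_one discriminant_lead U0 _ _).
  exact: eta_lead.
exact: eta_low.
Qed.
End EtaTheta.

(** * Divisibility of lacunary eta powers *)

(** The relevant index is [N = 24 n + d], so [l | N] encodes the congruence [24 r + d = 0] modulo
    [l]. *)
Definition dvs (l : nat) (f : fseries int) := forall N, (l %| N)%N -> (l%:Z %| f N)%Z.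

Definition anisotropic (l m m' : nat) := forall x y : int,
  (l%:Z %| m%:Z * (x * x) + m'%:Z * (y * y))%Z -> (l%:Z %| x)%Z && (l%:Z %| y)%Z.

Lemma dvsD l f g : dvs l f -> dvs l g -> dvs l (f + g).
Proof. by move=> df dg N lN; rewrite scoefD rpredD ?df ?dg. Qed.

Lemma dvsN l f : dvs l f -> dvs l (- f).
Proof. by move=> df N lN; rewrite scoefN rpredN df. Qed.

Lemma dvs_natM l k f : dvs l f -> dvs l (k%:R * f).
Proof. by move=> df N lN; rewrite scoef_nat dvdz_mull // df. Qed.

Lemma dvs_natM_inv l k f : coprime l k -> dvs l (k%:R * f) -> dvs l f.
Proof.
move=> lk df N lN; have := df N lN.
by rewrite scoef_nat natz Gauss_dvdzr // coprimezE.
Qed.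

Lemma dvs_theta_mul l m m' c c' : (0 < m)%N -> (0 < m')%N -> anisotropic l m m' ->
    (forall x y, (l%:Z %| x)%Z -> (l%:Z %| y)%Z -> (l%:Z %| c x * c' y)%Z) ->
  dvs l (theta c m * theta c' m').
Proof.
move=> m0 m'0 an lc N lN; rewrite theta_mul // /latsum.
elim/big_rec: _ => [|v s]; first exact: dvdz0.
case: v => x y /= /eqP xyN ls; rewrite rpredD //.
have /andP[lx ly] : (l%:Z %| x)%Z && (l%:Z %| y)%Z by apply: an; rewrite xyN.
exact: lc.
Qed.

Lemma iter_sder_theta i c m :
  iter i (@sder int) (theta c m) = theta (fun x => (m%:Z * (x * x)) ^+ i * c x) m.
Proof.
elim: i => [|i IH]; first by apply: eq_theta => x; rewrite expr0 mul1r.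
by rewrite iterS IH sder_theta; apply: eq_theta => x; rewrite exprS mulrA.
Qed.

(** A single application of [D] already brings a factor [x^2] or [y^2], which anisotropy makes
    divisible by [l]. *)
Lemma dvs_iter_sder l m m' c c' i j : (0 < m)%N -> (0 < m')%N -> anisotropic l m m' ->
  (0 < i + j)%N -> dvs l (iter i (@sder int) (theta c m) * iter j (@sder int) (theta c' m')).
Proof.
move=> m0 m'0 an ij; rewrite !iter_sder_theta; apply: dvs_theta_mul => // x y lx ly.
have lz (z c0 : int) k n : (0 < k)%N -> (l%:Z %| z)%Z -> (l%:Z %| (n * (z * z)) ^+ k * c0)%Z.
  by move=> k0 lz; apply: dvdz_mulr; apply: dvdz_exp => //; apply/dvdz_mull/dvdz_mull.
by case: i ij => [|i] ij; [apply: dvdz_mull | apply: dvdz_mulr]; apply: lz.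
Qed.

Lemma Fp_expr_pred l (x : 'F_l) : prime l -> x != 0 -> x ^+ l.-1 = 1.
Proof.
move=> pl x0; apply: (mulfI x0); rewrite mulr1 -exprS prednK ?prime_gt0 //.
by rewrite -[RHS](expf_card x) card_Fp.
Qed.

Lemma Fp_dvdz l (z : int) : prime l -> (l%:Z %| z)%Z = (z%:~R == 0 :> 'F_l).
Proof. by move=> pl; apply: dvdz_pcharf; apply: pchar_Fp. Qed.

Lemma Fp_natr_eq0 l k : prime l -> (k%:R == 0 :> 'F_l) = (l %| k)%N.
Proof. by move=> pl; rewrite (dvdn_pcharf (pchar_Fp pl)). Qed.

Lemma form_zero (F : fieldType) (k x y : F) : (forall t, t ^+ 2 != - k) ->
  x ^+ 2 + k * y ^+ 2 = 0 -> (x == 0) && (y == 0).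
Proof.
move=> nsq; have [->|y0] := eqVneq y 0.
  by rewrite expr0n /= mulr0 addr0 => /eqP; rewrite sqrf_eq0 => ->.
move/eqP; rewrite addr_eq0 => /eqP xy; case/eqP: (nsq (x / y)).
by rewrite expr_div_n xy mulNr mulfK // sqrf_eq0.
Qed.

Lemma anisotropic_of_nonsquare l q : prime l -> coprime l q ->
    (forall t : 'F_l, t ^+ 2 != - q%:R) ->
  anisotropic l 1 q.
Proof.
move=> pl lq nsq x y; rewrite !(Fp_dvdz _ pl) mul1r !(rmorphD, rmorphM) /=.
rewrite -!expr2 -pmulrn => /eqP; exact: form_zero.
Qed.

Lemma Fp_two_neq0 l : prime l -> (2 < l)%N -> (2%:R : 'F_l) != 0.
Proof. by move=> pl l2; rewrite Fp_natr_eq0 // gtnNdvd. Qed.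

(** If [t^2 = -1], then [t^(l-1) = (-1)^((l-1)/2) = -1] because [(l-1)/2] is odd, against Fermat. *)
Lemma anisotropic_gauss l : prime l -> (l = 3 %[mod 4])%N -> anisotropic l 1 1.
Proof.
move=> pl l3; apply: anisotropic_of_nonsquare => // [|t]; first exact: coprimen1.
have l_gt2 : (2 < l)%N by have := prime_gt1 pl; lia.
apply/eqP => t2; have t0 : t != 0.
  by apply/eqP => t0; move: t2; rewrite t0 expr2 mulr0 => /eqP; rewrite eq_sym oppr_eq0 oner_eq0.
have := Fp_expr_pred pl t0.
have -> : (l.-1 = 2 * (l %/ 4).*2.+1)%N by lia.
rewrite exprM t2 -signr_odd /= odd_double /= => /eqP.
by rewrite expr1 eq_sym -subr_eq0 opprK -mulr2n (negbTE (Fp_two_neq0 pl l_gt2)).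
Qed.

(* A square root of -3 yields a primitive cube root of unity, impossible when
   3 does not divide l - 1. *)
Lemma anisotropic_eisenstein l : prime l -> (l = 5 %[mod 6])%N -> anisotropic l 1 3.
Proof.
move=> pl l5; have l_gt2 : (3 < l)%N by have := prime_gt1 pl; lia.
have n2 : (2%:R : 'F_l) != 0 by apply: Fp_two_neq0 => //; lia.
have n3 : (3%:R : 'F_l) != 0 by rewrite Fp_natr_eq0 // gtnNdvd.
apply: anisotropic_of_nonsquare => // [|t].
  by rewrite prime_coprime // gtnNdvd.
apply/eqP => t2; pose w := (t - 1) / 2%:R.
have tw : t = 2%:R * w + 1 by rewrite /w mulrC mulfVK ?subrK.
have w2 : w ^+ 2 + w + 1 = 0.
  apply: (mulfI (mulf_neq0 n2 n2)); rewrite mulr0 -[RHS](addrN (- 3%:R)) -[in X in _ = X + _]t2 tw.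
  by ring.
have w3 : w ^+ 3 = 1.
  by apply/eqP; rewrite -subr_eq0 -[0](mulr0 (w - 1)) -w2; apply/eqP; ring.
have w0 : w != 0.
  by apply/eqP => w0; move/eqP: w3; rewrite w0 expr0n /= eq_sym oner_eq0.
have := Fp_expr_pred pl w0.
(* Hence [w = w^(l-1) = 1], and [w^2 + w + 1 = 0] would give [3 = 0]. *)
have -> : (l.-1 = 3 * (l.-1 %/ 3) + 1)%N by lia.
rewrite exprD exprM w3 expr1n mul1r expr1 => w1.
move/eqP: w2; rewrite w1 expr1n; apply/negP.
by rewrite (_ : 1 + 1 + 1 = 3%:R) //; ring.
Qed.

(** Substitute [(a x, b y)] in [x^2 + q y^2], where [u], [a], [b] are units modulo [l]. *)
Lemma anisotropic_scale l q u a b : prime l -> anisotropic l 1 q ->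
    coprime l u -> coprime l a -> coprime l b ->
  anisotropic l (u * a ^ 2) (u * q * b ^ 2).
Proof.
move=> pl an lu la lb x y lxy.
have : (l%:Z %| u%:Z * (1%:Z * (a%:Z * x * (a%:Z * x)) + q%:Z * (b%:Z * y * (b%:Z * y))))%Z.
  move: lxy; rewrite -!mulnn !PoszM.
  by congr (_ %| _)%Z; ring.
rewrite Gauss_dvdzr ?coprimezE // => /an.
by rewrite !Gauss_dvdzr ?coprimezE.
Qed.

Section Dvs.
Variable l : nat.
Hypothesis pl : prime l.

Lemma coprime_pow2 k : (2 < l)%N -> coprime l (2 ^ k).
Proof. by move=> l2; rewrite coprimeXr // prime_coprime // gtnNdvd. Qed.

(** Euler's series times Jacobi's, on the form [x^2 + 3 y^2] with [y] in the weight. *)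
Lemma dvs_eta4 : (l = 5 %[mod 6])%N -> dvs l (eta 1 ^+ 4).
Proof.
move=> l5; have l2 : (2 < l)%N by have := prime_gt1 pl; lia.
apply: (dvs_natM_inv (coprime_pow2 2 l2)).
have -> : (2 ^ 2)%N%:R * eta 1 ^+ 4 = (2%:R * eta 1) * (2%:R * eta 1 ^+ 3) by ring.
rewrite -theta_eta // -theta_jacobi //.
apply: dvs_theta_mul => //; first exact: anisotropic_eisenstein.
by move=> x y lx ly; rewrite !mulrA dvdz_mull.
Qed.

Lemma dvs_eta6 : (5 <= l)%N -> (l = 3 %[mod 4])%N -> dvs l (eta 1 ^+ 6).
Proof.
move=> l5 l3; have l2 : (2 < l)%N by lia.
apply: (dvs_natM_inv (coprime_pow2 2 l2)).
have -> : (2 ^ 2)%N%:R * eta 1 ^+ 6 = (2%:R * eta 1 ^+ 3) * (2%:R * eta 1 ^+ 3) by ring.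
rewrite -theta_jacobi //.
apply: dvs_theta_mul => //.
  apply: (@anisotropic_scale l 1 3 1 1 pl); rewrite ?coprimen1 //.
    exact: anisotropic_gauss.
  by rewrite prime_coprime // gtnNdvd //; lia.
by move=> x y lx ly; rewrite !mulrA dvdz_mull.
Qed.

(** The form is [2 (x^2 + (2 y)^2)]; the constant 24 of [eta_order10] is invertible since
    [l >= 5]. *)
Lemma dvs_eta10 : (5 <= l)%N -> (l = 3 %[mod 4])%N -> dvs l (eta 1 ^+ 10).
Proof.
move=> l5 l3; have l2 : (2 < l)%N by lia.
have c24 : coprime l 24.
  by rewrite (@coprimeMr l 8 3) (coprime_pow2 3 l2) prime_coprime // gtnNdvd //; lia.
apply: (dvs_natM_inv c24); rewrite -eta_order10.
have an : anisotropic l 2 8.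
  apply: (@anisotropic_scale l 1 2 1 2 pl); rewrite ?coprimen1 ?(coprime_pow2 1 l2) //.
  exact: anisotropic_gauss.
apply: dvsD; last apply: dvsN; rewrite sder_theta; apply: dvs_theta_mul => //.
all: by move=> x y lx ly; rewrite !mulrA dvdz_mull.
Qed.

Lemma dvs_eta14 : (l = 5 %[mod 6])%N -> l != 5 -> dvs l (eta 1 ^+ 14).
Proof.
move=> l5 l_neq5; have l6 : (6 < l)%N by have := prime_gt1 pl; lia.
have l2 : (2 < l)%N by lia.
have c720 : coprime l 720.
  have p k : prime k -> (k < l)%N -> coprime l k.
    by move=> pk kl; rewrite prime_coprime // gtnNdvd // prime_gt0.
  rewrite (@coprimeMr l (2 ^ 4) 45) (coprime_pow2 4 l2) (@coprimeMr l (3 ^ 2) 5).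
  by rewrite coprimeXr !p //; lia.
apply: (dvs_natM_inv c720).
(* Doubling the bracket supplies the factor in [2 eta_2^3], a Jacobi series; the form becomes
   [8 x^2 + 6 y^2]. *)
have -> : 720%:R * eta 1 ^+ 14 = - (2%:R * (- 360%:R * eta 1 ^+ 14)) by ring.
rewrite -eta_order14; apply: dvsN.
have -> : 2%:R * (3%:R * sder (sder thetaW) * eta 2 ^+ 3
    - 10%:R * sder thetaW * sder (eta 2 ^+ 3) + 3%:R * thetaW * sder (sder (eta 2 ^+ 3))) =
  3%:R * (iter 2 (@sder int) thetaW * iter 0 (@sder int) (2%:R * eta 2 ^+ 3))
  - 10%:R * (iter 1 (@sder int) thetaW * iter 1 (@sder int) (2%:R * eta 2 ^+ 3))
  + 3%:R * (iter 0 (@sder int) thetaW * iter 2 (@sder int) (2%:R * eta 2 ^+ 3)).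
  by rewrite /= !sder_natM; ring.
rewrite -theta_jacobi //.
have an : anisotropic l 8 6.
  apply: (@anisotropic_scale l 3 2 2 1 pl); rewrite ?coprimen1 ?(coprime_pow2 1 l2) //.
  exact: anisotropic_eisenstein.
by apply: dvsD; [apply: dvsD; last apply: dvsN|]; apply: dvs_natM; apply: dvs_iter_sder.
Qed.

Lemma dvs_rc12 m m' c c' : (0 < m)%N -> (0 < m')%N -> anisotropic l m m' ->
  dvs l (rc12 (theta c m) (theta c' m')).
Proof.
move=> m0 m'0 an; rewrite /rc12 -!mulrA.
have D i j : (0 < i + j)%N ->
    dvs l (iter i (@sder int) (theta c m) * iter j (@sder int) (theta c' m')).
  exact: dvs_iter_sder.
do !apply: dvsD; try apply: dvsN; try apply: dvs_natM.
- exact: (D 6 0).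
- exact: (D 5 1).
- exact: (D 4 2).
- exact: (D 3 3).
- exact: (D 2 4).
- exact: (D 1 5).
- exact: (D 0 6).
Qed.

(** The two brackets live on [x^2 + y^2] and [2 (x^2 + 3 (2 y)^2)]; the condition modulo 12 makes
    both anisotropic, and for [l > 13] the constant is invertible. *)
Lemma dvs_eta26 : (l = 11 %[mod 12])%N -> l != 11 -> dvs l (eta 1 ^+ 26).
Proof.
move=> l11 l_neq11; have l13 : (13 < l)%N by have := prime_gt1 pl; lia.
have l2 : (2 < l)%N by lia.
have small p i f : prime p -> (p < l)%N -> dvs l (p%:R ^+ i * f) -> dvs l f.
  move=> pp p_lt; rewrite -natrX; apply: dvs_natM_inv.
  by rewrite coprimeXr // prime_coprime // gtnNdvd // prime_gt0.
suff : dvs l (rc12 (eta 1) (eta 1) + rc12 (eta 2) (theta sgp 24)).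
  rewrite eta_order26 => /(small 2 13)-/(_ isT l2) /(small 3 4)-/(_ isT).
  move=> /(_ (ltn_trans _ l13))-/(_ isT) /(small 11 2)-/(_ isT) /(_ (ltn_trans _ l13))-/(_ isT).
  by apply: (small 13 1).
apply: (dvs_natM_inv (coprime_pow2 2 l2)); rewrite -[(2 ^ 2)%N]/4%N.
have -> : 4%:R * (rc12 (eta 1) (eta 1) + rc12 (eta 2) (theta sgp 24)) =
  rc12 (2%:R * eta 1) (2%:R * eta 1) + 2%:R * rc12 (2%:R * eta 2) (theta sgp 24).
  have I n i f : iter i (@sder int) (n%:R * f) = n%:R * iter i (@sder int) f.
    by elim: i => // i IH; rewrite !iterS IH sder_natM.
  by rewrite /rc12 !I !sder_natM; ring.
rewrite -!theta_eta //; apply: dvsD; last apply: dvs_natM.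
  apply: dvs_rc12 => //; apply: anisotropic_gauss => //; lia.
apply: dvs_rc12 => //; apply: (@anisotropic_scale l 3 2 1 2 pl);
  rewrite ?coprimen1 ?(coprime_pow2 1 l2) //.
apply: anisotropic_eisenstein => //; lia.
Qed.
End Dvs.

Lemma spoly_qfact (p : {poly int}) n : spoly (qfact p n) = qfact (spoly p) n.
Proof. by rewrite rmorph_prod; apply: eq_bigr => i _; rewrite rmorphB rmorph1 rmorphXn. Qed.

(** A polynomial approximation of [eta 1], for which replacing [t] by [t^k] is composition of
    polynomials. *)
Definition etapoly K : {poly int} := 'X * qfact ('X^24) K.

Lemma eqstX (f g : fseries int) M k : eqst M f g -> eqst M (f ^+ k) (g ^+ k).
Proof.
by move=> fg; elim: k => [|k IH]; rewrite ?expr0 // !exprS; apply: eqstM.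
Qed.

Lemma eta_etapoly k K : (0 < k)%N -> eqst K (eta k) (spoly (etapoly K \Po 'X^k)).
Proof.
move=> k0.
have -> : spoly (etapoly K \Po 'X^k) = sX int ^+ k * qfact (sX int ^+ (24 * k)) K.
  rewrite /etapoly comp_polyM comp_polyX rmorphM; congr (_ * _); first exact: rmorphXn.
  have -> : qfact ('X^24) K \Po 'X^k = qfact ('X^(24 * k)) K :> {poly int}.
    rewrite [LHS]rmorph_prod; apply: eq_bigr => i _.
    rewrite -!exprM rmorphB rmorph1; congr (1 - _).
    by rewrite /= comp_Xn_poly -exprM; congr (_ ^+ _); lia.
  by rewrite -[LHS]/(spoly _) spoly_qfact; congr qfact; apply: rmorphXn.
rewrite eta.unlock; apply: eqstM; first exact: eqst_refl.
by apply/eqst_sym/pinfE => //; lia.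
Qed.

Lemma eta_scale k d N : (0 < k)%N ->
  (eta k ^+ d) N = if (k %| N)%N then (eta 1 ^+ d) (N %/ k)%N else 0.
Proof.
move=> k0.
rewrite (eqstX d (@eta_etapoly k N.+1 k0)) // -rmorphXn -rmorphXn /= coef_comp_poly_Xn //.
case: ifP => // kN; rewrite (eqstX d (@eta_etapoly 1 N.+1 isT)); last first.
  by rewrite ltnS leq_div.
by rewrite expr1 comp_polyXr -rmorphXn.
Qed.

Lemma eta_coef d n K : (24 * n + d < K)%N ->
  (eta 1 ^+ d) (24 * n + d)%N = (qfact 'X K ^+ d)`_n.
Proof.
move=> lt_K; rewrite (eqstX d (@eta_etapoly 1 K isT)) // expr1 comp_polyXr.
rewrite -rmorphXn /= /etapoly exprMn mulrC coefMXn ltnNge leq_addl /= addnK.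
have -> : qfact 'X^24 K = qfact 'X K \Po 'X^24 :> {poly int}.
  rewrite /qfact rmorph_prod; apply: eq_bigr => i _ /=.
  by rewrite rmorphB rmorph1 rmorphXn /= comp_polyX.
by rewrite -rmorphXn /= coef_comp_poly_Xn // dvdn_mulr // mulKn.
Qed.

(* The coefficients of eta_4^8 are those of eta_1^8 at quarter indices, whence an
   induction on the index. *)
Lemma dvs_eta8 l : prime l -> (l = 5 %[mod 6])%N -> dvs l (eta 1 ^+ 8).
Proof.
move=> pl l5; have l2 : (2 < l)%N by have := prime_gt1 pl; lia.
have an : anisotropic l 8 24.
  apply: (@anisotropic_scale l 3 8 1 1 pl); rewrite ?coprimen1 ?(coprime_pow2 pl 3 l2) //.
  exact: anisotropic_eisenstein.
have D : dvs l (eta 1 ^+ 8 + 32%:R * eta 4 ^+ 8).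
  apply: (dvs_natM_inv (coprime_pow2 pl 4 l2)); rewrite -eta_order8 -mulrA.
  apply: dvsD; [|apply/dvsN/dvs_natM]; rewrite sder_theta;
    apply: dvs_theta_mul => // x y lx ly.
    by apply/dvdz_mulr/dvdz_mulr/dvdz_mull/dvdz_mull.
  by apply/dvdz_mull/dvdz_mulr/dvdz_mull/dvdz_mull.
elim/ltn_ind => N IH lN; have := D N lN; rewrite scoefD scoef_nat (@eta_scale 4)//.
case: ifP => [N4|_]; last by rewrite mulr0 addr0.
(* At [N = 0] the quarter index is not smaller, but there the coefficient itself is zero. *)
have [N0 _|N_gt0] := posnP N.
  have e0 n : (n < 1)%N -> eta 1 n = 0 by apply: eta_low.
  by have [_ ->] := scoefX_lead 8 e0; rewrite ?dvdz0 // N0.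
rewrite rpredDr ?dvdz_mull // IH ?ltn_Pdiv //.
have := lN; rewrite -{1}(divnK N4) Gauss_dvdl //; exact: (coprime_pow2 pl 2 l2).
Qed.

(** * Reduction of rational exponents *)

Section LocalIntegers.
Variable l : nat.
Hypothesis pl : prime l.

(** The localization of the integers at [l], with an arbitrary denominator prime to [l], so that
    closure properties need no reduced fractions; [local_eq] is congruence modulo [l] in it. *)
Definition local_int (x : rat) := exists c m : int, coprimez m l /\ x * m%:~R = c%:~R.
Definition local_eq (x y : rat) := exists2 z, local_int z & x - y = l%:R * z.

Lemma coprimez_l_neq0 (m : int) : coprimez m l -> m%:~R != 0 :> rat.
Proof.
rewrite intr_eq0; apply: contraTneq => ->.
by rewrite /coprimez /gcdz gcd0n; have := prime_gt1 pl; lia.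
Qed.

Lemma local_intz (c : int) : local_int c%:~R.
Proof. by exists c, 1; rewrite mulr1 /coprimez /gcdz gcd1n. Qed.

Lemma local_intM x y : local_int x -> local_int y -> local_int (x * y).
Proof.
move=> [c [m [cm xm]]] [c' [m' [cm' ym']]]; exists (c * c'), (m * m').
by rewrite coprimezMl cm cm' !intrM -xm -ym' mulrACA.
Qed.

Lemma local_intD x y : local_int x -> local_int y -> local_int (x + y).
Proof.
move=> [c [m [cm xm]]] [c' [m' [cm' ym']]]; exists (c * m' + c' * m), (m * m').
rewrite coprimezMl cm cm' intrD !intrM -xm -ym'; split => //; ring.
Qed.

Lemma local_intN x : local_int x -> local_int (- x).
Proof. by move=> Zx; rewrite -mulN1r; apply: local_intM => //; apply: (local_intz (-1)). Qed.

Lemma local_intV (m : int) : coprimez m l -> local_int m%:~R^-1.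
Proof. by move=> cm; exists 1, m; split; rewrite // mulVf // coprimez_l_neq0. Qed.

Lemma local_int_sum (I : Type) (r : seq I) (F : I -> rat) :
  (forall i, local_int (F i)) -> local_int (\sum_(i <- r) F i).
Proof.
move=> ZF; elim/big_rec: _ => [|i x _ Zx]; first exact: (local_intz 0).
exact: local_intD.
Qed.

Lemma local_int_prod (I : Type) (r : seq I) (F : I -> rat) :
  (forall i, local_int (F i)) -> local_int (\prod_(i <- r) F i).
Proof.
move=> ZF; elim/big_rec: _ => [|i x _ Zx]; first exact: (local_intz 1).
exact: local_intM.
Qed.

Lemma local_eq_refl x : local_eq x x.
Proof. by exists 0; [apply: (local_intz 0) | rewrite subrr mulr0]. Qed.

Lemma local_eqD x y x' y' : local_eq x y -> local_eq x' y' -> local_eq (x + x') (y + y').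
Proof.
move=> [z Zz xy] [z' Zz' xy']; exists (z + z'); first exact: local_intD.
by rewrite mulrDr -xy -xy'; ring.
Qed.

Lemma local_eqM x y x' y' : local_int x -> local_int y' ->
  local_eq x y -> local_eq x' y' -> local_eq (x * x') (y * y').
Proof.
move=> Zx Zy' [z Zz xy] [z' Zz' xy']; exists (x * z' + z * y').
  by apply: local_intD; apply: local_intM.
transitivity (x * (x' - y') + (x - y) * y'); first by ring.
by rewrite xy xy'; ring.
Qed.

Lemma local_eq_sum (I : Type) (r : seq I) (F G : I -> rat) :
  (forall i, local_eq (F i) (G i)) -> local_eq (\sum_(i <- r) F i) (\sum_(i <- r) G i).
Proof.
move=> FG; elim/big_rec2: _ => [|i x y _ xy]; first exact: local_eq_refl.
exact: local_eqD.
Qed.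

Lemma local_int_eq x y : local_int y -> local_eq x y -> local_int x.
Proof.
move=> Zy [z Zz xy]; rewrite -(subrK y x) xy.
by apply: local_intD => //; apply: local_intM => //; apply: (local_intz l).
Qed.

Lemma local_eq_rat_eqmod0 (x : rat) (c : int) : (l%:Z %| c)%Z -> local_eq x c%:~R ->
  rat_eqmod0 x l.
Proof.
move=> /dvdzP[q ->] [z [c' [m [cm zm]]] xE].
have m0 : m%:~R != 0 :> rat := coprimez_l_neq0 cm.
have E : numq x * m = denq x * (l%:Z * (q * m + c')).
  apply: (@intr_inj rat); rewrite !intrM numqE intrD !intrM -zm.
  rewrite -(subrK (q * l)%:~R x) xE intrM -pmulrn; ring.
have dm : (denq x %| m)%Z.
  rewrite -(@Gauss_dvdzr _ (numq x)); last by rewrite /coprimez /gcdz gcdnC; apply: coprime_num_den.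
  by rewrite E dvdz_mulr // dvdzz.
have cd : coprimez (denq x) l by apply: coprimez_dvdl cm.
split=> //; rewrite -(@Gauss_dvdzl _ _ m); last by rewrite coprimez_sym.
by rewrite E mulrCA dvdz_mulr // dvdzz.
Qed.

(* The modulus l * (n!)_l absorbs the denominators i! of the binomials. *)
Lemma gbinom_congr (n M : nat) (k w : rat) : local_int k -> local_int w ->
    k - M%:R = (l * n`!`_l)%N%:R * w ->
  forall i, (i <= n)%N -> local_eq (gbinom k i) (gbinom M%:R i).
Proof.
move=> Zk Zw kM i le_in.
have Zj (x : rat) j : local_int x -> local_int (x - j%:R).
  by move=> Zx; apply: local_intD => //; apply/local_intN/(local_intz j).
(* Both products are values of one integer polynomial, at [k] and at [M], so their difference is a
   multiple of [k - M]. *)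
have [s Zs sE] : exists2 s, local_int s &
    \prod_(j < i) (k - j%:R) - \prod_(j < i) (M%:R - j%:R) = (k - M%:R) * s.
  elim: (i) => [|j [s Zs sE]].
    by exists 0; [apply: (local_intz 0) | rewrite !big_ord0 subrr mulr0].
  exists (\prod_(j' < j) (k - j'%:R) + s * (M%:R - j%:R)).
    apply: local_intD; first by apply: local_int_prod => j'; apply: Zj.
    by apply: local_intM => //; apply: Zj; apply: (local_intz M).
  rewrite !big_ord_recr /=.
  transitivity (\prod_(j' < j) (k - j'%:R) * (k - M%:R) +
    (\prod_(j' < j) (k - j'%:R) - \prod_(j' < j) (M%:R - j'%:R)) * (M%:R - j%:R)).
    by ring.
  by rewrite sE; ring.
have /dvdnP[u uE] : (i`!`_l %| n`!`_l)%N.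
  by apply: partn_dvd; rewrite ?fact_gt0 // -(bin_fact le_in) dvdn_mull // dvdn_mulr.
(* The part of [i!] prime to [l] is a local unit; its [l]-part divides that of [n!] and is absorbed
   by the modulus. *)
pose v := (i`!`_l^')%N.
have cv : coprimez v%:Z l.
  rewrite coprimezE /= coprime_sym -[l in coprime l _](part_pnat_id (pnat_id pl)).
  exact: coprime_partC.
have vi : (i`!)%:R = (i`!`_l)%N%:R * v%:R :> rat by rewrite -natrM partnC ?fact_gt0.
have p0 : (i`!`_l)%N%:R != 0 :> rat by rewrite pnatr_eq0 -lt0n part_gt0.
have v0 : v%:R != 0 :> rat by rewrite pnatr_eq0 -lt0n part_gt0.
exists (u%:R * w * s * v%:R^-1).
  do !apply: local_intM => //; first exact: (local_intz u).
  exact: (local_intV cv).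
rewrite /gbinom -mulrBl sE kM uE vi !natrM.
by field; rewrite p0 v0.
Qed.

Lemma qprod_congr (n K : nat) (k : rat) (M : nat) :
    local_int k -> (forall i, (i <= n)%N -> local_eq (gbinom k i) (gbinom M%:R i)) ->
    (forall i, local_int (gbinom M%:R i)) ->
  forall j, (j <= n)%N ->
    local_int (qprod M%:R K j) /\ local_eq (qprod k K j) (qprod M%:R K j).
Proof.
move=> Zk kM ZM; elim: K => [|K IH] j le_jn.
  by split; [apply: (local_intz (j == 0)%N) | apply: local_eq_refl].
have Zs i : local_int ((-1) ^+ i).
  elim: i => [|i Zi]; first exact: (local_intz 1).
  by rewrite exprS; apply: local_intM => //; apply: (local_intz (-1)).
have ZF i : local_int (one_sub_qpow M%:R K.+1 i).
  by rewrite /one_sub_qpow; case: ifP => _; [apply: local_intM | apply: (local_intz 0)].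
have EF i : (i <= n)%N -> local_eq (one_sub_qpow k K.+1 i) (one_sub_qpow M%:R K.+1 i).
  move=> le_in; rewrite /one_sub_qpow; case: ifP => _; last exact: local_eq_refl.
  have le_q : (i %/ K.+1 <= n)%N by apply: leq_trans le_in; apply: leq_div.
  apply: local_eqM (kM _ le_q) (local_eq_refl _) => //.
  exact: local_int_eq (ZM _) (kM _ le_q).
split.
  apply: local_int_sum => i; apply: local_intM; last exact: ZF.
  by apply: (IH _ _).1; have := ltn_ord i; lia.
apply: local_eq_sum => i; have lt_i := ltn_ord i.
have [ZK EK] : local_int (qprod M%:R K i) /\ local_eq (qprod k K i) (qprod M%:R K i).
  by apply: IH; lia.
by apply: local_eqM => //; [apply: local_int_eq ZK EK | apply: EF; lia].
Qed.
End LocalIntegers.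

Lemma gbinom_nat M i : gbinom M%:R i = 'C(M, i)%:R.
Proof.
rewrite /gbinom; apply: (canLR (mulfK _)); first by rewrite pnatr_eq0 -lt0n fact_gt0.
rewrite -natrM bin_ffact; elim: i => [|i IH]; first by rewrite big_ord0 ffactn0.
rewrite big_ord_recr /= IH ffactnSr natrM.
have [lt_Mi|le_iM] := ltnP M i; first by rewrite ffact_small // !mul0r.
by rewrite natrB.
Qed.

Lemma coef_one_sub_Xn (M m n : nat) : (0 < m)%N ->
  (((1 - 'X^m) ^+ M : {poly int})`_n)%:~R = one_sub_qpow M%:R m n.
Proof.
move=> m0; have -> : (1 - 'X^m) ^+ M = (1 - 'X) ^+ M \Po 'X^m :> {poly int}.
  by rewrite rmorphXn rmorphB rmorph1 /= comp_polyX.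
rewrite coef_comp_poly_Xn // /one_sub_qpow gbinom_nat; case: ifP => // _.
move: (n %/ m)%N => i.
have -> : (1 - 'X) ^+ M = \poly_(j < M.+1) ((-1) ^+ j *+ 'C(M, j)) :> {poly int}.
  rewrite exprBn poly_def; apply: eq_bigr => j _.
  by rewrite expr1n mulr1 -scalerMnl -mul_polyC rmorphXn rmorphN1.
rewrite coef_poly; case: ltnP => [_|lt_Mi]; last by rewrite bin_small // mul0r.
by rewrite rmorphMn rmorphXn rmorphN1 /= mulr_natl.
Qed.

Lemma qprod_nat (M K n : nat) :
  qprod M%:R K n = ((qfact 'X K ^+ M : {poly int})`_n)%:~R.
Proof.
elim: K n => [|K IH] n.
  by rewrite /qfact big_ord0 expr1n coef1 /= /fps_one; case: eqP.
rewrite /= /fps_mul qfactS exprMn coefM rmorph_sum /=; apply: eq_bigr => i _.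
by rewrite rmorphM /= coef_one_sub_Xn // IH.
Qed.

Lemma qfact_frobenius l K : prime l ->
  (qfact 'X K) ^+ l = qfact 'X K \Po 'X^l :> {poly 'F_l}.
Proof.
move=> pl; have chl : l \in [pchar {poly 'F_l}] by rewrite pchar_poly pchar_Fp.
rewrite /qfact -prodrXl rmorph_prod; apply: eq_bigr => i _ /=.
rewrite rmorphB rmorph1 rmorphXn /= comp_polyX exprAC.
have C : GRing.comm 1 ('X^(i.+1) : {poly 'F_l}) by apply: commr_sym; apply: commr1.
have := pFrobenius_autB_comm chl C.
by rewrite !pFrobenius_autE expr1n => ->.
Qed.

(** By Frobenius the factor of exponent [l m] is modulo [l] a polynomial in [X^l], so multiplying by
    it mixes only coefficients whose indices lie in one residue class modulo [l]. *)
Lemma qfact_congr (l d m r n K : nat) : prime l -> (r < l)%N ->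
    (forall n', (n' <= n)%N -> (l%:Z %| (qfact 'X K ^+ d : {poly int})`_(l * n' + r))%Z) ->
  (l%:Z %| (qfact 'X K ^+ (d + l * m) : {poly int})`_(l * n + r))%Z.
Proof.
move=> pl lt_rl dl; pose f := map_poly (intr : int -> 'F_l).
have fE (p : {poly int}) i : (l%:Z %| p`_i)%Z = ((f p)`_i == 0).
  by rewrite coef_map /= (Fp_dvdz _ pl).
have fQ : f (qfact 'X K) = qfact 'X K.
  rewrite /f /qfact rmorph_prod; apply: eq_bigr => i _.
  by rewrite rmorphB rmorph1 rmorphXn /= map_polyX.
have dF n' : (n' <= n)%N -> (qfact 'X K ^+ d : {poly 'F_l})`_(l * n' + r) = 0.
  by move=> le_n; apply/eqP; rewrite -fQ -rmorphXn -fE dl.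
rewrite fE /f rmorphXn /= -/f fQ exprD exprM qfact_frobenius // -rmorphXn /=.
rewrite coefMr big1 // => i _; have lt_i := ltn_ord i.
rewrite coef_comp_poly_Xn ?prime_gt0 //; case: ifP => [/dvdnP[q qE]|_]; last by rewrite mulr0.
have le_qn : (q <= n)%N.
  rewrite leqNgt; apply/negP => lt_nq.
  have : (l * n.+1 <= q * l)%N by rewrite mulnC leq_mul2r lt_nq orbT.
  lia.
rewrite (_ : l * n + r - i = l * (n - q) + r)%N; first by rewrite dF ?mul0r // leq_subr.
have le_ql : (l * q <= l * n)%N by rewrite leq_mul2l le_qn orbT.
by rewrite qE mulnBr [(q * l)%N]mulnC; lia.
Qed.

(** A natural number close to [-a/b]: modulo [T] by Bezout, and of the form [d + l m] because [l]
    divides both [T] and [a + d b]. *)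
Lemma natural_approx (a b : int) (d l T : nat) : prime l -> (l %| T)%N -> (0 < T)%N ->
    coprimez b T -> coprimez b l -> (l %| a + d%:Z * b)%Z ->
  exists m q, a + b * (d + l * m)%N%:Z = T%:Z * q.
Proof.
move=> pl lT T0 /coprimezP[[u v] /= uv] bl lab.
(* As [u] inverts [b] modulo [T], [-a u] represents [-a/b]; the added multiple of [T] forces
   [M >= d]. *)
pose M := - (a * u) + T%:Z * (`|a * u| + d%:Z).
have M_ge : d%:Z <= M by rewrite /M; nia.
have aM : a + b * M = T%:Z * (a * v + b * (`|a * u| + d%:Z)).
  by rewrite /M -{1}[a]mulr1 -uv; ring.
have /dvdzP[m mE] : (l %| M - d%:Z)%Z.
  rewrite -(@Gauss_dvdzr _ b); last by rewrite coprimez_sym.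
  have -> : b * (M - d%:Z) = (a + b * M) - (a + d%:Z * b) by ring.
  by rewrite rpredB // aM dvdz_mulr.
exists (absz m), (a * v + b * (`|a * u| + d%:Z)); rewrite -aM; congr (_ + _ * _).
have m_ge0 : 0 <= m by have := prime_gt0 pl; nia.
by rewrite PoszD PoszM gez0_abs // [l%:Z * _]mulrC -mE; ring.
Qed.

(** Transfers divisibility from the exponent [d] to [d + l m] by Frobenius, then to [-a/b] by
    [l]-adic continuity of the binomials. *)
Lemma pcoef_congr (a b : int) (d l r : nat) : prime l -> (r < l)%N ->
    1 <= b -> coprimez a b -> (l %| a + d%:Z * b)%Z ->
    (forall n, (l%:Z %| (eta 1 ^+ d) (24 * (l * n + r) + d)%N)%Z) ->
  forall n, rat_eqmod0 (pcoef (- (a%:~R / b%:~R)) (l * n + r)) l.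
Proof.
move=> pl lt_rl b1 ab lab eta0 n; set N := (l * n + r)%N; set k := - _.
have bl : coprimez b l.
  rewrite coprimez_sym coprimezE /= prime_coprime //; apply/negP => lb.
  have la : (l %| a)%Z by move: lab; rewrite rpredDr // dvdz_mull.
  have : (l %| gcdz a b)%Z by rewrite dvdz_gcd la.
  by rewrite (eqP ab) dvdz1 => /eqP /= l1; move: pl; rewrite l1.
have bN : coprimez b (l * N`!`_l)%N.
  rewrite PoszM coprimezMr bl coprimezE /= p_part.
  by rewrite coprimeXr // -coprimezE.
have T0 : (0 < l * N`!`_l)%N by rewrite muln_gt0 prime_gt0 // part_gt0.
have [m [q mq]] := natural_approx pl (dvdn_mulr _ (dvdnn l)) T0 bN bl lab.
have b0 : b%:~R != 0 :> rat by rewrite intr_eq0; lia.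
have Zk : local_int l k.
  apply/local_intN/local_intM => //; first exact: local_intz.
  exact: local_intV.
have kM : k - (d + l * m)%N%:R = (l * N`!`_l)%N%:R * (- q%:~R / b%:~R).
  have := congr1 (fun c : int => c%:~R : rat) mq.
  rewrite intrD (intrM _ b) (intrM _ _ q) => E.
  apply: (mulIf b0); rewrite mulrBl -[RHS]mulrA divfK // /k mulNr divfK //.
  by move: E; rewrite -!pmulrn mulrN => <-; ring.
have gc := gbinom_congr pl Zk _ kM.
have Zw : local_int l (- q%:~R / b%:~R).
  by apply: local_intM => //; [apply/local_intN/local_intz | apply: local_intV].
(* Large enough for both [eta_coef] and [qprod_stable]. *)
pose K := (24 * N + d).+1.
have gZ i : local_int l (gbinom (d + l * m)%N%:R i).
  by rewrite gbinom_nat; apply: (local_intz l 'C(_, _)).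
have [_ E] := qprod_congr pl K Zk (gc Zw) gZ (leqnn N).
apply: (@local_eq_rat_eqmod0 l pl _ ((qfact 'X K ^+ (d + l * m) : {poly int})`_N)).
  apply: qfact_congr => // n' le_n'; rewrite -eta_coef //.
  rewrite /K /N ltnS leq_add2r leq_mul2l leq_add2r leq_mul2l le_n' orbT //.
by rewrite -qprod_nat -(@qprod_stable k N K) // /K; lia.
Qed.

(** * Exponents 1 and 3, and the case analysis *)

Lemma nonresidue_sqr l (c : int) (r n : nat) (x : int) : quad_nonresidue l (c * r%:Z + 1) ->
  x * x != c * (l * n + r)%N%:Z + 1.
Proof.
move=> [_ nres]; apply/eqP => xE; apply: nres; exists x.
apply/eqP; rewrite eqz_mod_dvd expr2 xE PoszD PoszM.
by apply/dvdzP; exists (c * n%:Z); ring.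
Qed.

(** Euler's series has only square exponents, and an exponent [24 (l n + r) + 1 = x^2] would make
    [24 r + 1] a square modulo [l]. *)
Lemma eta1_vanish l r n : quad_nonresidue l (24 * r%:Z + 1) ->
  (eta 1 ^+ 1) (24 * (l * n + r) + 1)%N = 0.
Proof.
move=> nres; set N := (24 * _ + 1)%N.
have : theta chi12 1 N = 0.
  apply: big1 => x /eqP xN; have := nonresidue_sqr n x nres.
  by have := sqr_absz x; rewrite /N in xN; lia.
by rewrite theta_eta // scoef_nat expr1 natz; lia.
Qed.

(** In Jacobi's series the exponent [3 x^2] forces [x^2 = 8 (l n + r) + 1]: impossible for a
    nonresidue, and if [l] divides [8 r + 1] it divides the weight [x]. *)
Lemma eta3_vanish l r n : prime l ->
    quad_nonresidue l (8 * r%:Z + 1) \/ (8 * r%:Z + 1 = 0 %[mod l])%Z ->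
  (l%:Z %| (eta 1 ^+ 3) (24 * (l * n + r) + 3)%N)%Z.
Proof.
move=> pl res; set N := (24 * _ + 3)%N.
have E : theta (fun x => chi4 x * x) 3 N = 2%:Z * (eta 1 ^+ 3) N.
  by rewrite (theta_jacobi (isT : (0 < 1)%N)) scoef_nat natz.
have sqN (x : int) : (3 * absz x ^ 2 == N)%N -> x * x = 8 * (l * n + r)%N%:Z + 1.
  by move=> /eqP xN; have := sqr_absz x; rewrite /N in xN; lia.
case: res => [nres|r0].
  have : theta (fun x => chi4 x * x) 3 N = 0.
    by apply: big1 => x /sqN xN; case/eqP: (nonresidue_sqr n x nres).
  by rewrite E => E0; rewrite (_ : (eta 1 ^+ 3) N = 0) ?dvdz0 //; lia.
have lr : (l%:Z %| 8 * r%:Z + 1)%Z by apply/dvdz_mod0P; rewrite r0 mod0z.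
(* [l] is odd because it divides the odd number [8 r + 1]. *)
have l2 : coprimez l 2.
  rewrite coprimezE /= coprime_sym prime_coprime // dvdn_prime2 //.
  by apply: contraTneq lr => <-; apply/negP => /dvdzP[q]; lia.
rewrite -(Gauss_dvdzr _ l2) -E /=.
elim/big_rec: _ => [|x s /sqN xN ls]; first exact: dvdz0.
rewrite rpredD //; apply: dvdz_mull.
suff : (l%:Z %| x * x)%Z by rewrite !dvdzE abszM Euclid_dvdM // orbb.
rewrite xN; have -> : 8 * (l * n + r)%N%:Z + 1 = 8 * n%:Z * l%:Z + (8 * r%:Z + 1).
  by rewrite PoszD PoszM; ring.
by rewrite rpredD // dvdz_mull.
Qed.

Lemma dvs_coef (l d r n : nat) : (24 * r%:Z + d%:Z = 0 %[mod l])%Z -> dvs l (eta 1 ^+ d) ->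
  (l%:Z %| (eta 1 ^+ d) (24 * (l * n + r) + d)%N)%Z.
Proof.
move=> r0; apply; have : (l%:Z %| 24 * r%:Z + d%:Z)%Z by apply/dvdz_mod0P; rewrite r0 mod0z.
rewrite dvdzE /= => lr.
by rewrite mulnDr mulnCA -addnA dvdn_addr // dvdn_mulr.
Qed.

Theorem theorem1p2 (a b d : int) (l r : nat)
  (hb : 1 <= b) (hab : coprimez a b)
  (hl : prime l) (hdvd : (l %| a + d * b)%Z) (hr : (r < l)%N)
  (hcond :
     (d = 1 /\ quad_nonresidue l (24 * r%:Z + 1))
  \/ (d = 3 /\ (quad_nonresidue l (8 * r%:Z + 1) \/
                (8 * r%:Z + 1 = 0 %[mod l])%Z))
  \/ (d \in [:: 4; 8; 14] /\ (l = 5 %[mod 6])%N /\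
      (24 * r%:Z + d = 0 %[mod l])%Z)
  \/ (d \in [:: 6; 10] /\ (5 <= l)%N /\ (l = 3 %[mod 4])%N /\
      (24 * r%:Z + d = 0 %[mod l])%Z)
  \/ (d = 26 /\ (l = 11 %[mod 12])%N /\
      (24 * r%:Z + d = 0 %[mod l])%Z)) :
  forall n : nat, rat_eqmod0 (pcoef (- (a%:~R / b%:~R)) (l * n + r)) l.
Proof.
(* The hypotheses depend on [d] only modulo [l], which permits a smaller exponent at the exceptional
   primes. *)
have shift (d' : int) : (l %| d - d')%Z ->
    (24 * r%:Z + d = 0 %[mod l])%Z -> (24 * r%:Z + d' = 0 %[mod l])%Z /\ (l %| a + d' * b)%Z.
  move=> ld /eqP; rewrite eqz_mod_dvd subr0 => lr; split.
    apply/eqP; rewrite eqz_mod_dvd subr0.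
    have -> : 24 * r%:Z + d' = (24 * r%:Z + d) - (d - d') by ring.
    by rewrite rpredB.
  have -> : a + d' * b = (a + d * b) - (d - d') * b by ring.
  by rewrite rpredB // dvdz_mulr.
have main (d' : nat) : (l %| d - d'%:Z)%Z -> (24 * r%:Z + d = 0 %[mod l])%Z ->
    dvs l (eta 1 ^+ d') ->
    forall n : nat, rat_eqmod0 (pcoef (- (a%:~R / b%:~R)) (l * n + r)) l.
  move=> ld lr De; have [lr' lab] := shift _ ld lr.
  by apply: (pcoef_congr hl hr hb hab lab) => n; apply: dvs_coef.
case: hcond => [[dE nres]|[[dE res]|[[]|[[]|]]]].
- rewrite dE in hdvd; apply: (@pcoef_congr a b 1 l r) => // n.
  by rewrite eta1_vanish // dvdz0.
- rewrite dE in hdvd; apply: (@pcoef_congr a b 3 l r) => // n.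
  exact: eta3_vanish.
- rewrite !inE => /or3P[] /eqP dE [l5 lr].
  + by apply: (main 4) => //; [rewrite dE subrr dvdz0 | apply: dvs_eta4].
  + by apply: (main 8) => //; [rewrite dE subrr dvdz0 | apply: dvs_eta8].
  (* The constant 360 of eta_order14 vanishes modulo 5, but 14 = 4 modulo 5. *)
  have [l_eq5|l_neq5] := eqVneq l 5.
    by apply: (main 4) => //; [rewrite dE l_eq5 | apply: dvs_eta4].
  by apply: (main 14) => //; [rewrite dE subrr dvdz0 | apply: dvs_eta14].
- rewrite !inE => /orP[] /eqP dE [l_ge5 [l3 lr]].
  + by apply: (main 6) => //; [rewrite dE subrr dvdz0 | apply: dvs_eta6].
  by apply: (main 10) => //; [rewrite dE subrr dvdz0 | apply: dvs_eta10].
(* Likewise 11 divides the constant of eta_order26, but 26 = 4 modulo 11. *)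
move=> [dE [l11 lr]]; have [l_eq11|l_neq11] := eqVneq l 11.
  by apply: (main 4) => //; [rewrite dE l_eq11 | apply: dvs_eta4 => //; rewrite l_eq11].
by apply: (main 26) => //; [rewrite dE subrr dvdz0 | apply: dvs_eta26].
Qed.
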